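(* Let $n,m,t,c_1,\ldots,c_t$ be positive integers. Let $G=\mathbf{Z}\stackrel{n}{*}\mathbf{Z}\stackrel{n}{*}\cdots\stackrel{n}{*}\mathbf{Z}$ be the free $n$th nilpotent group of rank $m$ (the $n$th nilpotent product of $m$ copies of $\mathbf{Z}$) and let $\mathcal{N}_{c_1,\ldots,c_t}$ be the variety of polynilpotent groups of class row $(c_1,\ldots,c_t)$. If $c_1\ge n$, then the Baer invariant $\mathcal{N}_{c_1,\ldots,c_t}M(G)$ is the free abelian group of rank $$\chi_{c_t+1}\Big(\ldots\Big(\chi_{c_2+1}\Big(\sum_{i=c_1+1}^{c_1+n}\chi_i(m)\Big)\Big)\ldots\Big)$$ (for $t=1$ the rank is $\sum_{i=c_1+1}^{c_1+n}\chi_i(m)$).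
   Context: Baer invariant: if $G\cong F/R$ with $F$ free and $\mathcal{V}$ is a variety defined by a set of words $V$, then $\mathcal{V}M(G)=\dfrac{R\cap V(F)}{[RV^*F]}$, where $V(F)$ is the verbal subgroup of $F$ and $[RV^*F]$ is the subgroup generated by all $v(f_1,\ldots,f_{i-1},f_ir,f_{i+1},\ldots,f_k)\,v(f_1,\ldots,f_i,\ldots,f_k)^{-1}$ with $r\in R$, $v\in V$, $f_j\in F$, $1\le i\le k$, $k\in\mathbf{N}$. The word $\gamma_c$ is the left-normed commutator $[x_1,\ldots,x_c]$. The variety $\mathcal{N}_{c_1,\ldots,c_t}$ of polynilpotent groups of class row $(c_1,\ldots,c_t)$ is defined by the single word $\gamma_{c_t+1}(\gamma_{c_{t-1}+1}(\ldots(\gamma_{c_1+1})\ldots))$, obtained by iterated substitution using distinct variables (the word $w_1=\gamma_{c_1+1}$, and $w_{s}$ is $\gamma_{c_s+1}$ evaluated at $c_s+1$ copies of $w_{s-1}$ in disjoint sets of variables); its verbal subgroup in a group $H$ is $\gamma_{c_t+1}(\ldots(\gamma_{c_1+1}(H))\ldots)$, where $\gamma_k(\cdot)$ denotes the $k$th lower central term. The $n$th nilpotent product of groups $G_1,\ldots,G_m$ is $P/(\gamma_{n+1}(P)\cap[G_i]^* )$, where $P$ is the free product of the $G_i$ and $[G_i]^*$ is the normal closure in $P$ of the subgroups $[G_i,G_j]$, $i\ne j$. For $G_i=\mathbf{Z}$ this is the free nilpotent group $F/\gamma_{n+1}(F)$ of class $n$ and rank $m$, $F$ being free of rank $m$.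 $\chi_k(d)=\frac1k\sum_{j\mid k}\mu(j)d^{k/j}$, with $\mu$ the Möbius function (the number of basic commutators of weight $k$ on $d$ generators). *)

(* Defs.v *)
From HB Require Import structures.
From mathcomp Require Import all_boot all_order all_algebra generic_quotient.
From mathcomp Require Import boolp classical_sets.

Set Implicit Arguments.
Unset Strict Implicit.
Unset Printing Implicit Defensive.

Local Open Scope classical_set_scope.
Local Open Scope quotient_scope.
Local Open Scope group_scope.

Definition isomorphic (G H : groupType) : Prop :=
  exists f : {multiplicative G -> H}, bijective f.

Lemma gmorph1 (G H : groupType) (f : {multiplicative G -> H}) : f 1 = 1.
Proof. by apply: (mulgI (f 1)); rewrite -gmulfM !mulg1. Qed.

Lemma gmorphV (G H : groupType) (f : {multiplicative G -> H}) x :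
  f x^-1 = (f x)^-1.
Proof. by apply: (mulgI (f x)); rewrite -gmulfM !mulgV gmorph1. Qed.

Section Subgroups.
Variable G : groupType.
Implicit Types (A B : set G) (x y g : G).

Definition is_subgroup A : Prop := A 1 /\ forall x y, A x -> A y -> A (x / y).

Definition is_normal A : Prop :=
  is_subgroup A /\ forall x g, A x -> A (x ^ g).

Definition generated A : set G := smallest is_subgroup A.

Definition normal_closure A : set G := smallest is_normal A.

Definition comm_subgroup A B : set G :=
  generated [set z | exists x y, [/\ A x, B y & z = [~ x, y]]].

(* lower_central k is the k-th term, starting from lower_central 1 = G *)
Definition lower_central (k : nat) : set G :=
  iter k.-1 (fun A => comm_subgroup A [set: G]) [set: G].

Lemma subgroupV A x : is_subgroup A -> A x -> A x^-1.
Proof. by move=> [A1 AF] Ax; rewrite -div1g; apply: AF. Qed.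

Lemma subgroupM A x y : is_subgroup A -> A x -> A y -> A (x * y).
Proof.
by move=> sA Ax Ay; rewrite -[y]invgK; apply: sA.2 => //; apply: subgroupV.
Qed.

Lemma subgroup_setT : is_subgroup [set: G].
Proof. by []. Qed.

Lemma normal_setT : is_normal [set: G].
Proof. by []. Qed.

Lemma subgroupI A B : is_subgroup A -> is_subgroup B -> is_subgroup (A `&` B).
Proof.
move=> [A1 AF] [B1 BF]; split=> // x y [Ax Bx] [Ay By].
by split; [apply: AF | apply: BF].
Qed.

Lemma normalI A B : is_normal A -> is_normal B -> is_normal (A `&` B).
Proof.
move=> [sA nA] [sB nB]; split; first exact: subgroupI.
by move=> x g [Ax Bx]; split; [apply: nA | apply: nB].
Qed.

Lemma sub_generated A : A `<=` generated A.
Proof. exact: sub_smallest. Qed.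

Lemma generated_sub A B : is_subgroup B -> A `<=` B -> generated A `<=` B.
Proof. exact: smallest_sub. Qed.

Lemma generated_subgroup A : is_subgroup (generated A).
Proof.
split=> [B [sB _]|x y Ax Ay B AB]; first exact: sB.1.
by apply: AB.1.2; [apply: Ax | apply: Ay].
Qed.

Lemma generated_normal A :
  (forall x g, A x -> A (x ^ g)) -> is_normal (generated A).
Proof.
move=> nA; split=> [|x g]; first exact: generated_subgroup.
have sAg := generated_subgroup A.
suff: generated A `<=` [set y | generated A (y ^ g)] by apply.
apply: generated_sub => [|y Ay]; last by apply: sub_generated; apply: nA.
split=> /= [|y z Ay Az]; first by rewrite conj1g; apply: sAg.1.
by rewrite conjMg conjVg; apply: sAg.2.
Qed.

Lemma normal_closure_normal A : is_normal (normal_closure A).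
Proof.
split; first split.
- move=> B [[[B1 _] _] _]. exact: B1.
- by move=> x y Ax Ay B AB; apply: AB.1.1.2; [apply: Ax | apply: Ay].
- by move=> x g Ax B AB; apply: AB.1.2; apply: Ax.
Qed.

Lemma comm_subgroup_normal A B :
  is_normal A -> is_normal B -> is_normal (comm_subgroup A B).
Proof.
move=> [_ nA] [_ nB]; apply: generated_normal => _ g [x [y [Ax By ->]]].
by exists (x ^ g), (y ^ g); rewrite conjRg; split; [apply: nA | apply: nB |].
Qed.

Lemma lower_central_normal k : is_normal (lower_central k).
Proof.
rewrite /lower_central; elim: k.-1 => [|j IHj] /=; first exact: normal_setT.
exact: comm_subgroup_normal normal_setT.
Qed.

Record subgroup := Subgroup {
  subgroup_set :> set G;
  subgroup_setP : is_subgroup subgroup_set }.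

Record normal_subgroup := NormalSubgroup {
  normal_set :> set G;
  normal_setP : is_normal normal_set }.

End Subgroups.

Section SubgroupGroup.
Variables (G : groupType) (A : subgroup G).

Definition subgroup_type : Type := {x : G | x \in subgroup_set A}.
HB.instance Definition _ := [isSub of subgroup_type for @sval _ _].
HB.instance Definition _ := [Choice of subgroup_type by <:].

Fact subgroup_group_closed :
  group_closed (fun x : G => x \in subgroup_set A).
Proof.
have [A1 AF] := subgroup_setP A.
split=> [|x y]; rewrite !unfold_in => *; apply: mem_set => //.
by apply: AF; apply: set_mem.
Qed.

HB.instance Definition _ :=
  SubChoice_isSubGroup.Build G _ subgroup_type subgroup_group_closed.

End SubgroupGroup.

Section QuotientGroup.
Variables (G : groupType) (N : normal_subgroup G).

Definition coset_eq : rel G := fun x y => `[< normal_set N (x^-1 * y) >].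

Fact coset_eq_refl : reflexive coset_eq.
Proof. by move=> x; apply/asboolP; rewrite mulVg; apply: (normal_setP N).1.1. Qed.

Fact coset_eq_sym : symmetric coset_eq.
Proof.
suff coset_sym x y : coset_eq x y -> coset_eq y x.
  by move=> x y; apply/idP/idP; apply: coset_sym.
move/asboolP=> Nxy; apply/asboolP.
by have := subgroupV (normal_setP N).1 Nxy; rewrite invgM invgK.
Qed.

Fact coset_eq_trans : transitive coset_eq.
Proof.
move=> y x z /asboolP Nxy /asboolP Nyz; apply/asboolP.
by have := subgroupM (normal_setP N).1 Nxy Nyz; rewrite mulgA mulgK.
Qed.

Canonical coset_equiv :=
  EquivRel coset_eq coset_eq_refl coset_eq_sym coset_eq_trans.

Definition quotient_group : Type := {eq_quot coset_equiv}.
HB.instance Definition _ := Choice.on quotient_group.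

Definition coset_of (x : G) : quotient_group := \pi_({eq_quot coset_equiv}) x.

Lemma coset_ofP x y : coset_of x = coset_of y <-> normal_set N (x^-1 * y).
Proof.
split; first by move/eqmodP => /asboolP.
by move=> Nxy; apply/eqmodP/asboolP.
Qed.

Definition quotient_repr (a : quotient_group) : G :=
  repr (a : {eq_quot coset_equiv}).

Lemma quotient_reprK : cancel quotient_repr coset_of.
Proof. exact: reprK. Qed.

Definition quotient_one : quotient_group := coset_of 1.
Definition quotient_mul (a b : quotient_group) : quotient_group :=
  coset_of (quotient_repr a * quotient_repr b).
Definition quotient_inv (a : quotient_group) : quotient_group :=
  coset_of (quotient_repr a)^-1.

Fact quotient_mulE x y :
  quotient_mul (coset_of x) (coset_of y) = coset_of (x * y).
Proof.
have /coset_ofP Nx := quotient_reprK (coset_of x).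
have /coset_ofP Ny := quotient_reprK (coset_of y).
apply/coset_ofP; move: Nx Ny.
set x' := quotient_repr _; set y' := quotient_repr _ => Nx Ny.
have -> : (x' * y')^-1 * (x * y) = (x'^-1 * x) ^ y' * (y'^-1 * y).
  by rewrite /conjg invgM !mulgA mulgK.
by apply: subgroupM (normal_setP N).1 _ Ny; apply: (normal_setP N).2.
Qed.

Fact quotient_invE x : quotient_inv (coset_of x) = coset_of x^-1.
Proof.
have /coset_ofP Nx := quotient_reprK (coset_of x).
apply/coset_ofP; move: Nx; set x' := quotient_repr _ => Nx.
have -> : x'^-1^-1 * x^-1 = (x'^-1 * x)^-1 ^ x'^-1.
  by rewrite /conjg invgM !invgK !mulgA mulgK.
by apply: (normal_setP N).2; apply: subgroupV (normal_setP N).1 _.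
Qed.

Fact quotient_mulA : associative quotient_mul.
Proof.
move=> a b c; rewrite -[a]quotient_reprK -[b]quotient_reprK -[c]quotient_reprK.
by rewrite !quotient_mulE mulgA.
Qed.

Fact quotient_mul1 : left_id quotient_one quotient_mul.
Proof. by move=> a; rewrite -[a]quotient_reprK quotient_mulE mul1g. Qed.

Fact quotient_mulr1 : right_id quotient_one quotient_mul.
Proof. by move=> a; rewrite -[a]quotient_reprK quotient_mulE mulg1. Qed.

Fact quotient_mulV : left_inverse quotient_one quotient_inv quotient_mul.
Proof.
by move=> a; rewrite -[a]quotient_reprK quotient_invE quotient_mulE mulVg.
Qed.

Fact quotient_mulrV : right_inverse quotient_one quotient_inv quotient_mul.
Proof.
by move=> a; rewrite -[a]quotient_reprK quotient_invE quotient_mulE mulgV.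
Qed.

HB.instance Definition _ := isGroup.Build quotient_group
  quotient_mulA quotient_mul1 quotient_mulr1 quotient_mulV quotient_mulrV.

HB.instance Definition _ :=
  isMultiplicative.Build G quotient_group coset_of
    (fun x y => esym (quotient_mulE x y)).

End QuotientGroup.

(* A / B, as the quotient of the group A by the preimage of B under its       *)
(* inclusion in G; this is meant for B contained in A.                        *)
Section SectionGroup.
Variables (G : groupType) (A : subgroup G) (B : normal_subgroup G).

Definition sub_in : set (subgroup_type A) := [set x | normal_set B (val x)].

Fact sub_in_normal : is_normal sub_in.
Proof.
have [[B1 BF] nB] := normal_setP B.
split; first split; rewrite /sub_in /=.
- exact: B1.
- by move=> x y Bx By; apply: BF.
- by move=> x g Bx; exact: nB.
Qed.

Definition section_group : groupType :=
  quotient_group (NormalSubgroup sub_in_normal).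

End SectionGroup.

Section FreeProduct.
Variables (I : choiceType) (G : I -> groupType).

Definition letters := seq {i : I & G i}.
Definition letter (i : I) (x : G i) : {i : I & G i} := existT _ i x.

Inductive free_product_rel : letters -> letters -> Prop :=
| FPrefl u : free_product_rel u u
| FPsym u v : free_product_rel u v -> free_product_rel v u
| FPtrans u v w :
    free_product_rel u v -> free_product_rel v w -> free_product_rel u w
| FPone u v i :
    free_product_rel (u ++ letter (1 : G i) :: v) (u ++ v)
| FPmul u v i (x y : G i) :
    free_product_rel (u ++ [:: letter x, letter y & v])
                     (u ++ letter (x * y) :: v).

Definition free_product_eq : rel letters :=
  fun u v => `[< free_product_rel u v >].

Fact free_product_eq_refl : reflexive free_product_eq.
Proof. by move=> u; apply/asboolP/FPrefl. Qed.

Fact free_product_eq_sym : symmetric free_product_eq.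
Proof. by move=> u v; apply/asboolP/asboolP; apply: FPsym. Qed.

Fact free_product_eq_trans : transitive free_product_eq.
Proof.
by move=> v u w /asboolP uv /asboolP vw; apply/asboolP/(FPtrans uv vw).
Qed.

Canonical free_product_equiv := EquivRel free_product_eq
  free_product_eq_refl free_product_eq_sym free_product_eq_trans.

Definition free_product : Type := {eq_quot free_product_equiv}.
HB.instance Definition _ := Choice.on free_product.

Definition free_product_pi (u : letters) : free_product :=
  \pi_({eq_quot free_product_equiv}) u.
Definition free_product_repr (a : free_product) : letters :=
  repr (a : {eq_quot free_product_equiv}).

Definition free_product_in (i : I) (x : G i) : free_product :=
  free_product_pi [:: letter x].

Fact free_product_piP u v :
  free_product_pi u = free_product_pi v <-> free_product_rel u v.
Proof.
split; first by move/eqmodP => /asboolP.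
by move=> uv; apply/eqmodP/asboolP.
Qed.

Fact free_product_reprK : cancel free_product_repr free_product_pi.
Proof. exact: reprK. Qed.

Fact free_product_rel_cat u u' v v' : free_product_rel u u' ->
  free_product_rel v v' -> free_product_rel (u ++ v) (u' ++ v').
Proof.
move=> uu' vv'; apply: (@FPtrans _ (u' ++ v)).
  elim: uu' => {u u'} [u|u w _|u w z _ uw _ wz|u w i|u w i x y].
  - exact: FPrefl.
  - exact: FPsym.
  - exact: FPtrans uw wz.
  - by rewrite -!catA; exact: FPone.
  - by rewrite -!catA; exact: FPmul.
elim: vv' => {v v'} [v|v w _|v w z _ uw _ wz|v w i|v w i x y].
- exact: FPrefl.
- exact: FPsym.
- exact: FPtrans uw wz.
- by rewrite !catA; exact: FPone.
- by rewrite !catA; exact: FPmul.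
Qed.

Definition letters_inv (u : letters) : letters :=
  rev [seq letter (tagged a)^-1 | a : {i : I & G i} <- u].

Fact letters_inv_cat u v : letters_inv (u ++ v) = letters_inv v ++ letters_inv u.
Proof. by rewrite /letters_inv map_cat rev_cat. Qed.

Fact free_product_rel_inv u v :
  free_product_rel u v -> free_product_rel (letters_inv u) (letters_inv v).
Proof.
elim=> {u v} [u|u w _|u w z _ uw _ wz|u w i|u w i x y].
- exact: FPrefl.
- exact: FPsym.
- exact: FPtrans uw wz.
- rewrite -cat1s !letters_inv_cat -catA {2}/letters_inv /= /rev /= invg1.
  exact: FPone.
- rewrite -(cat1s (letter (x * y))) -[[:: _, _ & w]]/([:: _; _] ++ w).
  rewrite !letters_inv_cat -!catA.
  by rewrite {2 5}/letters_inv /= /rev /= invgM; exact: FPmul.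
Qed.

Fact free_product_relV u : free_product_rel (letters_inv u ++ u) [::].
Proof.
elim: u => [|[i x] u IHu]; first exact: FPrefl.
rewrite -cat1s letters_inv_cat -catA {2}/letters_inv /= /rev /=.
apply: FPtrans (FPmul _ _ _ _) _; rewrite mulVg.
exact: FPtrans (FPone _ _ _) IHu.
Qed.

Fact letters_invK : involutive letters_inv.
Proof.
move=> u; rewrite /letters_inv map_rev revK -map_comp map_id_in //.
by case=> i x _ /=; rewrite invgK.
Qed.

Definition free_product_mul (a b : free_product) : free_product :=
  free_product_pi (free_product_repr a ++ free_product_repr b).
Definition free_product_inv (a : free_product) : free_product :=
  free_product_pi (letters_inv (free_product_repr a)).

Fact free_product_mulE u v :
  free_product_mul (free_product_pi u) (free_product_pi v)
  = free_product_pi (u ++ v).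
Proof.
by apply/free_product_piP/free_product_rel_cat;
  apply/free_product_piP; rewrite free_product_reprK.
Qed.

Fact free_product_invE u :
  free_product_inv (free_product_pi u) = free_product_pi (letters_inv u).
Proof.
apply/free_product_piP/free_product_rel_inv.
by apply/free_product_piP; rewrite free_product_reprK.
Qed.

Fact free_product_mulA : associative free_product_mul.
Proof.
move=> a b c; rewrite -[a]free_product_reprK -[b]free_product_reprK.
by rewrite -[c]free_product_reprK !free_product_mulE catA.
Qed.

Fact free_product_mul1 : left_id (free_product_pi [::]) free_product_mul.
Proof. by move=> a; rewrite -[a]free_product_reprK free_product_mulE. Qed.

Fact free_product_mulr1 : right_id (free_product_pi [::]) free_product_mul.
Proof. by move=> a; rewrite -[a]free_product_reprK free_product_mulE cats0. Qed.

Fact free_product_mulV :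
  left_inverse (free_product_pi [::]) free_product_inv free_product_mul.
Proof.
move=> a; rewrite -[a]free_product_reprK free_product_invE free_product_mulE.
exact/free_product_piP/free_product_relV.
Qed.

Fact free_product_mulrV :
  right_inverse (free_product_pi [::]) free_product_inv free_product_mul.
Proof.
move=> a; rewrite -[a]free_product_reprK free_product_invE free_product_mulE.
apply/free_product_piP; rewrite -{1}[free_product_repr a]letters_invK.
exact: free_product_relV.
Qed.

HB.instance Definition _ := isGroup.Build free_product free_product_mulA
  free_product_mul1 free_product_mulr1 free_product_mulV free_product_mulrV.

Fact free_product_in_morph i :
  {morph @free_product_in i : x y / x * y}.
Proof.
move=> x y; rewrite /free_product_in [RHS]free_product_mulE.
exact/esym/free_product_piP/(@FPmul [::] [::]).
Qed.

HB.instance Definition _ i :=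
  isMultiplicative.Build (G i) free_product (@free_product_in i)
    (@free_product_in_morph i).

End FreeProduct.

Section FreeProductUniversal.
Variables (I : choiceType) (G : I -> groupType) (H : groupType).
Variable f : forall i, {multiplicative G i -> H}.

Definition letters_eval (u : letters G) : H :=
  \prod_(a <- u) f (tag a) (tagged a).

Fact letters_eval_rel u v :
  free_product_rel u v -> letters_eval u = letters_eval v.
Proof.
rewrite /letters_eval.
elim=> {u v} [//|u v _ -> //|u v w _ -> //|u v i|u v i x y];
  rewrite !big_cat !big_cons /=.
- by rewrite gmorph1 mul1g.
- by rewrite gmulfM !mulgA.
Qed.

Definition free_product_lift (a : free_product G) : H :=
  letters_eval (free_product_repr a).

Fact free_product_liftE u :
  free_product_lift (free_product_pi u) = letters_eval u.
Proof.
by apply: letters_eval_rel; apply/free_product_piP; rewrite free_product_reprK.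
Qed.

Fact free_product_lift_morph : {morph free_product_lift : a b / a * b}.
Proof.
move=> a b; rewrite -[a]free_product_reprK -[b]free_product_reprK.
rewrite [free_product_pi _ * _]free_product_mulE !free_product_liftE.
exact: big_cat.
Qed.

HB.instance Definition _ :=
  isMultiplicative.Build (free_product G) H free_product_lift
    free_product_lift_morph.

Lemma free_product_lift_in i x :
  free_product_lift (free_product_in x) = f i x.
Proof. by rewrite free_product_liftE /letters_eval big_seq1. Qed.

Lemma free_product_lift_unique (psi : {multiplicative free_product G -> H}) :
  (forall i (x : G i), psi (free_product_in x) = f i x) ->
  psi =1 free_product_lift.
Proof.
move=> psif a; rewrite -[a]free_product_reprK free_product_liftE.
elim: (free_product_repr a) => [|[i x] u IHu]; rewrite /letters_eval.
  by rewrite big_nil; exact: gmorph1.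
rewrite big_cons /= -psif -[X in _ = _ * X]IHu -gmulfM.
by congr (psi _); apply/esym/free_product_mulE.
Qed.

End FreeProductUniversal.

Section NilpotentProduct.
Variables (I : choiceType) (G : I -> groupType).

Definition cartesian_subgroup : set (free_product G) :=
  normal_closure [set z | exists i j, i != j /\
    comm_subgroup (range (@free_product_in I G i))
                  (range (@free_product_in I G j)) z].

Definition nilpotent_relations (n : nat) : normal_subgroup (free_product G) :=
  @NormalSubgroup (free_product G) (lower_central n.+1 `&` cartesian_subgroup)
    (normalI (lower_central_normal _ n.+1) (normal_closure_normal _)).

Definition nilpotent_product (n : nat) : groupType :=
  quotient_group (nilpotent_relations n).

End NilpotentProduct.

Definition free_basis (F : groupType) (X : Type) (b : X -> F) : Prop :=
  forall (H : groupType) (f : X -> H),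
  exists phi : {multiplicative F -> H},
    (forall x, phi (b x) = f x) /\
    forall psi : {multiplicative F -> H},
      (forall x, psi (b x) = f x) -> psi =1 phi.

Definition is_free (F : groupType) : Prop :=
  exists (X : Type) (b : X -> F), free_basis b.

(* the group of integers, and the free abelian group of rank r, written       *)
(* multiplicatively *)
Definition mulZ : groupType := Algebra.to_multiplicative int.
Definition free_abelian (r : nat) : groupType :=
  Algebra.to_multiplicative 'rV[int]_r.

Section FreeGroupExistence.

Definition zpow (H : groupType) (x : H) (z : mulZ) : H :=
  match (z : int) with Posz n => x ^+ n | Negz n => x ^- n.+1 end.

Fact zpow_morph (H : groupType) (x : H) : {morph zpow x : y z / y * z}.
Proof.
have zpowS (y : int) : zpow x (y + 1)%R = zpow x y * x.
  case: y => [n|[|n]].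
  - by rewrite -[1%R]/(Posz 1) -PoszD addn1; exact: expgSr.
  - by rewrite NegzE GRing.addNr /zpow /= mulVg.
  - have -> : (Negz n.+1 + 1)%R = Negz n.
      by rewrite !NegzE -[n.+2]addn1 PoszD GRing.opprD GRing.addrNK.
    by rewrite /zpow [x ^+ n.+2]expgS invgM mulgVK.
have zpowP (y : int) : zpow x (y - 1)%R = zpow x y * x^-1.
  by rewrite -[in RHS](GRing.subrK 1%R y) zpowS mulgK.
move=> y z; change (zpow x ((y : int) + (z : int))%R = zpow x y * zpow x z).
elim/int_rect: (z : int) => [|n IHn|n IHn].
- by rewrite GRing.addr0 mulg1.
- by rewrite -addn1 PoszD GRing.addrA !zpowS IHn mulgA.
- by rewrite -addn1 PoszD GRing.opprD GRing.addrA !zpowP IHn mulgA.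
Qed.

HB.instance Definition _ (H : groupType) (x : H) :=
  isMultiplicative.Build mulZ H (zpow x) (zpow_morph x).

Variable X : choiceType.

Definition free_group : groupType := free_product (fun _ : X => mulZ).

Definition free_gen (x : X) : free_group :=
  @free_product_in X (fun=> mulZ) x (1%R : int).

Lemma free_group_basis : free_basis free_gen.
Proof.
move=> H f; pose h (x : X) : {multiplicative mulZ -> H} := zpow (f x).
exists (free_product_lift h); split=> [x|psi psif].
  by rewrite [LHS](free_product_lift_in h); exact: expg1.
apply: free_product_lift_unique => x.
pose psix : {multiplicative mulZ -> H} :=
  psi \o @free_product_in X (fun=> mulZ) x.
pose one : mulZ := (1%R : int).
have psixS (z : int) : psix (z + 1)%R = psix z * psix one.
  exact: (@gmulfM _ _ psix z one).
have hS (z : int) : h x (z + 1)%R = h x z * h x one.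
  exact: (@gmulfM _ _ (h x) z one).
have psix1 : psix one = h x one by rewrite [LHS]psif; apply/esym/expg1.
suff psixE z : psix z = h x z by exact: psixE.
elim/int_rect: (z : int) => [|n IHn|n IHn].
- by rewrite (gmorph1 psix) (gmorph1 (h x)).
- by rewrite -addn1 PoszD psixS hS IHn psix1.
- apply: (mulIg (psix one)); rewrite -psixS psix1 -hS.
  by rewrite -[n.+1]addn1 PoszD GRing.opprD GRing.subrK.
Qed.

End FreeGroupExistence.

Lemma free_group_is_free X : is_free (free_group X).
Proof. by exists X, (@free_gen X); exact: free_group_basis. Qed.

Lemma free_presentation (G : groupType) :
  exists R : normal_subgroup (free_group G), isomorphic G (quotient_group R).
Proof.
have [phi [phiE _]] := @free_group_basis G G id.
have kerN : is_normal [set x | phi x = 1].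
  split; first split=> [|x y /= x1 y1]; first exact: gmorph1.
    by rewrite gmulfM gmorphV x1 y1 divgg.
  by move=> x g /= x1; rewrite !gmulfM gmorphV x1 mul1g mulVg.
pose R := NormalSubgroup kerN; exists R.
pose psi (g : G) : quotient_group R := coset_of R (free_gen g).
have psiM : {morph psi : g h / g * h}.
  move=> g h; rewrite /psi -gmulfM; apply/coset_ofP.
  by rewrite /= !gmulfM gmorphV !phiE mulVg.
pose psiA := isMultiplicative.Build _ _ psi psiM.
pose psi' : {multiplicative G -> quotient_group R} := HB.pack psi psiA.
exists psi'; exists (fun a => phi (quotient_repr a)) => [g|a] /=.
  have /coset_ofP /= := quotient_reprK (psi g).
  by rewrite gmulfM gmorphV phiE => /(canRL (mulVKg _)); rewrite mulg1 => /esym.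
rewrite -[RHS]quotient_reprK; apply/coset_ofP => /=.
by rewrite gmulfM gmorphV phiE mulVg.
Qed.

Inductive word :=
| WVar of nat
| WOne
| WMul of word & word
| WInv of word.

Fixpoint word_eval (G : groupType) (f : nat -> G) (w : word) : G :=
  match w with
  | WVar i => f i
  | WOne => 1
  | WMul u v => word_eval f u * word_eval f v
  | WInv u => (word_eval f u)^-1
  end.

Fixpoint word_subst (s : nat -> word) (w : word) : word :=
  match w with
  | WVar i => s i
  | WOne => WOne
  | WMul u v => WMul (word_subst s u) (word_subst s v)
  | WInv u => WInv (word_subst s u)
  end.

Definition word_comm (u v : word) : word :=
  WMul (WInv u) (WMul (WInv v) (WMul u v)).

(* [x_0, ..., x_(c-1)], left-normed *)
Definition gamma_word (c : nat) : word :=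
  foldl word_comm (WVar 0) [seq WVar i | i <- iota 1 c.-1].

(* From a word in the variables x_0, ..., x_(k-1), paired with k, to          *)
(* gamma_(c+1) evaluated at c+1 copies of it, the i-th copy being written in  *)
(* the variables x_(i*k), ..., x_(i*k+k-1).                                   *)
Definition polynilpotent_step (wk : word * nat) (c : nat) : word * nat :=
  let: (w, k) := wk in
  (word_subst (fun i => word_subst (fun j => WVar (i * k + j)%N) w)
     (gamma_word c.+1),
   (c.+1 * k)%N).

(* the class row is (c1, c2, ..., ct) with cs = [:: c2; ...; ct] *)
Definition polynilpotent_word (c1 : nat) (cs : seq nat) : word :=
  (foldl polynilpotent_step (gamma_word c1.+1, c1.+1) cs).1.

Definition polynilpotent_laws (c1 : nat) (cs : seq nat) : set word :=
  [set polynilpotent_word c1 cs].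

Lemma word_eval_morph (G H : groupType) (phi : {multiplicative G -> H})
  (f : nat -> G) w : phi (word_eval f w) = word_eval (phi \o f) w.
Proof.
elim: w => //= [|u <- v <-|u <-]; first exact: gmorph1.
- exact: gmulfM.
- exact: gmorphV.
Qed.

Section BaerInvariant.
Variables (F : groupType) (R : normal_subgroup F) (V : set word).

Definition verbal_subgroup : set F :=
  generated [set z | exists v f, V v /\ z = word_eval f v].

(* [RV*F]; a word involves only finitely many of the variables, and changing  *)
(* f at another variable contributes the trivial generator 1.                 *)
Definition marginal_commutator : set F :=
  generated [set z | exists v f i r, [/\ V v, normal_set R r &
    z = word_eval (fun j => if j == i then f j * r else f j) v
        / word_eval f v]].

Lemma word_evalJ (f : nat -> F) g w :
  word_eval f w ^ g = word_eval (fun j => f j ^ g) w.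
Proof.
elim: w => //= [|u <- v <-|u <-]; first exact: conj1g.
- exact: conjMg.
- exact: conjVg.
Qed.

Lemma marginal_commutator_normal : is_normal marginal_commutator.
Proof.
apply: generated_normal => _ g [v [f [i [r [Vv Rr ->]]]]].
exists v, (fun j => f j ^ g), i, (r ^ g); split=> //.
  exact: (normal_setP R).2.
rewrite conjMg conjVg !word_evalJ; congr (word_eval _ _ / _).
by apply/funext => j; case: eqP => // _; exact: conjMg.
Qed.

Lemma marginal_commutator_sub :
  marginal_commutator `<=` normal_set R `&` verbal_subgroup.
Proof.
apply: generated_sub => [|_ [v [f [i [r [Vv Rr ->]]]]]].
  exact: subgroupI (normal_setP R).1 (generated_subgroup _).
have sV := generated_subgroup
  [set z | exists v f, V v /\ z = word_eval (G := F) f v].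
split; last first.
  by apply: sV.2; apply: sub_generated; exists v; eexists; split.
set f' := fun j => _.
have eq_ff' : coset_of R \o f = coset_of R \o f'.
  apply/funext => j /=; apply/coset_ofP; rewrite /f'.
  case: eqP => _; last by rewrite mulVg; apply: (normal_setP R).1.1.
  by rewrite mulKg.
have /coset_ofP Rff' :
    coset_of R (word_eval f v)^-1 = coset_of R (word_eval f' v)^-1.
  by rewrite !gmorphV !word_eval_morph eq_ff'.
have := subgroupV (normal_setP R).1 Rff'.
by rewrite invgM !invgK.
Qed.

Definition baer_numerator : subgroup F :=
  @Subgroup F (normal_set R `&` verbal_subgroup)
    (subgroupI (normal_setP R).1 (generated_subgroup _)).

Definition baer_invariant : groupType :=
  section_group baer_numerator (NormalSubgroup marginal_commutator_normal).

End BaerInvariant.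

Local Open Scope ring_scope.

Definition moebius (n : nat) : int :=
  if all (fun p => logn p n == 1%N) (primes n) then (-1) ^+ size (primes n)
  else 0.

(* The argument d is rational, so that no integrality is built in. *)
Definition chi (k : nat) (d : rat) : rat :=
  k%:R^-1 * \sum_(j <- divisors k) (moebius j)%:~R * d ^+ (k %/ j)%N.

Definition baer_rank (n m c1 : nat) (cs : seq nat) : rat :=
  foldl (fun d c => chi c.+1 d) (\sum_(c1.+1 <= i < (c1 + n).+1%N) chi i m%:R) cs.

(* Main.v *)
From HB Require Import structures.
Require Import Defs.
From mathcomp Require Import all_boot all_order all_algebra.
From mathcomp Require Import boolp classical_sets zify ring.

(** Put [H = gamma_(c1+1)(F)] and [K = [R, F, ..., F]] with [c1] copies of [F];
    then, for each further entry [c] of the class row, replace [(K, H)] by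
    [([K, H, ..., H], gamma_(c+1)(H))] with [c] copies of [H]. The polynilpotent
    word is an iterated commutator in distinct variables whose first variable is
    the leftmost one, so its values generate the last [H], and its values with
    the first variable in [R] generate the last [K]: these are the verbal
    subgroup and [[R V* F]] ([verbal_polynilpotent], [marginal_polynilpotent]).
    Since [n <= c1], the group [R] contains [gamma_(c1+1)(F)], and the Baer
    invariant is the last section [H / K].

    The rank of [H / K] is computed step by step. Homomorphisms between [H] and
    [H2] that are mutually inverse modulo [K] and [K2] induce an isomorphism
    between [gamma_(c+1)(H) / [K, H, ..., H]] and its analogue for [(K2, H2)]
    ([fa_section_lcs]). An isomorphism between [H / K] and [H2 / K2] lifts to
    such homomorphisms as soon as [H] and [H2] are projective. Free groups are
    projective, and so are their subgroups, because homomorphisms of a subgroup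
    induce homomorphisms of the whole group into a wreath product
    ([subgroup_projective]). Hence [(R, F)] may be replaced by
    [(gamma_(n+1)(E), E)] with [E] free of rank [m], and later each [(K, H)] with
    [H / K] free abelian of rank [N] by [(gamma_2(E), E)] with [E] free of rank
    [N] ([fa_section_step]). What remains are [gamma_(c1+1)(E) /
    gamma_(c1+n+1)(E)], which is abelian because [n <= c1 + 1] and therefore the
    direct sum of its [n] lower central factors ([fa_section_free_nilpotent]),
    and [gamma_(c+1)(E) / gamma_(c+2)(E)].

    The factor [gamma_k(E) / gamma_(k+1)(E)] of a free group is free abelian on
    the commutators attached to the Lyndon words of length [k]
    ([fa_section_free_group]). They span it, by rewriting with the Jacobi
    identity ([lyndon_span_bracket]); they are independent, because the Magnus
    expansion of the commutator of [w] starts with the word [w]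
    ([lyndon_comm_lead]). Every word is a power of a rotation of a unique Lyndon
    word, so that Moebius inversion counts the Lyndon words of length [k] on [d]
    letters as [chi k d] ([sum_lyndon_words], [chi_lyndon]). *)

Set Implicit Arguments.
Unset Strict Implicit.
Unset Printing Implicit Defensive.

(** * Commutator calculus *)

HB.instance Definition _ (G : groupType) (N : normal_subgroup G) :=
  Multiplicative_isUMagmaMorphism.Build G (quotient_group N) (coset_of N)
    (gmorph1 (coset_of N)).

Section Commutators.
Local Open Scope classical_set_scope.
Local Open Scope group_scope.
Variable G : groupType.
Implicit Types (A B C H K N X Y Z : set G) (x y z g : G).

Lemma coset_eq1P N (nN : is_normal N) x :
  coset_of (NormalSubgroup nN) x = 1 <-> N x.
Proof.
have -> : (1 : quotient_group (NormalSubgroup nN)) = coset_of _ 1 by [].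
split=> [/esym/coset_ofP /=|Nx]; first by rewrite invg1 mul1g.
by apply/esym/coset_ofP; rewrite /= invg1 mul1g.
Qed.

Lemma coset_commute N (nN : is_normal N) x y :
  commute (coset_of (NormalSubgroup nN) x) (coset_of (NormalSubgroup nN) y)
  <-> N [~ x, y].
Proof.
rewrite -(coset_eq1P nN) gmulfR; split=> [cxy|/eqP/commgP//].
by apply/eqP/commgP.
Qed.

Lemma comm_subgroup_sub A B C : is_subgroup C ->
  (forall x y, A x -> B y -> C [~ x, y]) -> comm_subgroup A B `<=` C.
Proof.
by move=> sC ABC; apply: generated_sub => // _ [x [y [Ax By ->]]]; apply: ABC.
Qed.

Lemma mem_comm_subgroup A B x y :
  A x -> B y -> comm_subgroup A B [~ x, y].
Proof. by move=> Ax By; apply: sub_generated; exists x, y. Qed.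

Lemma comm_subgroup_subgroup A B : is_subgroup (comm_subgroup A B).
Proof. exact: generated_subgroup. Qed.

Lemma comm_subgroupC A B : comm_subgroup A B = comm_subgroup B A.
Proof.
suff sub X Y : comm_subgroup X Y `<=` comm_subgroup Y X.
  by apply/seteqP; split; apply: sub.
apply: comm_subgroup_sub (comm_subgroup_subgroup _ _) _ => x y Xx Yy.
rewrite -invgR; apply: subgroupV (comm_subgroup_subgroup _ _) _.
exact: mem_comm_subgroup.
Qed.

Lemma comm_subgroupS A A' B B' :
  A `<=` A' -> B `<=` B' -> comm_subgroup A B `<=` comm_subgroup A' B'.
Proof.
move=> sA sB; apply: comm_subgroup_sub (comm_subgroup_subgroup _ _) _.
by move=> x y /sA A'x /sB B'y; exact: mem_comm_subgroup.
Qed.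

Lemma comm_subgroup_subl A B : is_normal A -> comm_subgroup A B `<=` A.
Proof.
move=> [sA nA]; apply: comm_subgroup_sub => // x y Ax _.
by rewrite commgEl; apply: subgroupM => //; [exact: subgroupV | exact: nA].
Qed.

(** Modulo a normal subgroup, the elements commuting with a given set form a
    subgroup; so commutator inclusions need only be tested on generators. *)
Lemma comm_generated_sub N X Y : is_normal N ->
  (forall x y, X x -> Y y -> N [~ x, y]) ->
  comm_subgroup (generated X) (generated Y) `<=` N.
Proof.
move=> nN XYN; apply: comm_subgroup_sub nN.1 _ => x y Xx Yy.
pose p := coset_of (NormalSubgroup nN).
have centS (a : quotient_group (NormalSubgroup nN)) :
    is_subgroup [set z | commute (p z) a].
  split=> [|z1 z2 /= c1 c2]; first exact/commute_sym/commute1.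
  rewrite /p gmulfF; apply/commute_sym/commuteM; first exact/commute_sym.
  exact/commuteV/commute_sym.
apply/(coset_commute nN).
suff : generated X `<=` [set z | commute (p z) (p y)] by apply.
apply: generated_sub (centS _) _ => {Xx}x Xx /=.
suff : generated Y `<=` [set z | commute (p z) (p x)].
  by move=> /(_ _ Yy) /commute_sym.
apply: generated_sub (centS _) _ => {Yy}y Yy /=.
exact/commute_sym/(coset_commute nN)/XYN.
Qed.

Lemma Hall_Witt x y z :
  [~ x, y^-1, z] ^ y * [~ y, z^-1, x] ^ z * [~ z, x^-1, y] ^ x = 1.
Proof.
(* each factor is a quotient of two cyclic shifts of a: the product telescopes *)
pose a u v w : G := u * w * u^-1 * v * u.
suff hw u v w : [~ u, v^-1, w] ^ v = (a u v w)^-1 * a v w u.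
  rewrite !hw; move: (a x y z) (a y z x) (a z x y) => b c d.
  by rewrite !mulgA !mulgK mulVg.
rewrite /a /conjg /commg /conjg ?(invgM, invgK) ?mulgA.
by rewrite ?(mulgK, mulgVK, mulVg, mul1g, mulg1).
Qed.

(** The Hall-Witt identity expresses the third commutator through the other
    two, up to conjugation. *)
Lemma three_subgroups A B C N :
  is_normal N -> is_normal A -> is_normal B -> is_normal C ->
  comm_subgroup (comm_subgroup A B) C `<=` N ->
  comm_subgroup (comm_subgroup B C) A `<=` N ->
  comm_subgroup (comm_subgroup C A) B `<=` N.
Proof.
move=> nN nA nB nC sABC sBCA.
have [_ NJ] := nN.
have -> : B = generated B.
  apply/seteqP; split; first exact: sub_generated.
  by apply: generated_sub nB.1 _.
apply: comm_generated_sub => // _ b [c [a [Cc Aa ->]]] Bb.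
suff : N ([~ c, a, b] ^ a^-1) by move/(NJ _ a); rewrite -conjgM mulVg conjg1.
have hw := Hall_Witt a^-1 b c.
rewrite invgK in hw.
have sV := subgroupV.
have N1 : N ([~ a^-1, b^-1, c] ^ b).
  apply: NJ; apply: sABC; apply: mem_comm_subgroup => //.
  by apply: mem_comm_subgroup; apply: subgroupV => //; [exact: nA.1|exact: nB.1].
have N2 : N ([~ b, c^-1, a^-1] ^ c).
  apply: NJ; apply: sBCA; apply: mem_comm_subgroup; last exact: sV nA.1 _.
  by apply: mem_comm_subgroup => //; exact: sV nC.1 _.
have -> : [~ c, a, b] ^ a^-1 =
    ([~ a^-1, b^-1, c] ^ b * [~ b, c^-1, a^-1] ^ c)^-1.
  apply: (mulgI ([~ a^-1, b^-1, c] ^ b * [~ b, c^-1, a^-1] ^ c)).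
  by rewrite hw mulgV.
by apply: subgroupV nN.1 _; apply: subgroupM nN.1 N1 N2.
Qed.

(** A lower central series relative to [X]: [lcs H H] is the series of [H]
    itself, and [lcs K H c] is what the Baer invariant of [H / K] for the
    variety of nilpotent groups of class [c] divides by. *)
Definition lcs X H (c : nat) : set G := iter c (fun Z => comm_subgroup Z H) X.

Lemma lcsS X H c : lcs X H c.+1 = comm_subgroup (lcs X H c) H.
Proof. by []. Qed.

Lemma lcsD X H a b : lcs (lcs X H a) H b = lcs X H (b + a).
Proof. by rewrite /lcs iterD. Qed.

Lemma lcs_normal K H c : is_normal K -> is_normal H -> is_normal (lcs K H c).
Proof.
by move=> nK nH; elim: c => //= c IHc; exact: comm_subgroup_normal.
Qed.

Lemma lcsW K H a b : is_normal K -> is_normal H -> a <= b ->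
  lcs K H b `<=` lcs K H a.
Proof.
move=> nK nH /subnK <-; elim: (b - a) => //= d IHd.
by apply: subset_trans IHd; apply: comm_subgroup_subl; exact: lcs_normal.
Qed.

Lemma lcs_monol K K' H c : K `<=` K' -> lcs K H c `<=` lcs K' H c.
Proof. by move=> sK; elim: c => //= c IHc; exact: comm_subgroupS. Qed.

(** By induction on [b], as [[X, [Y, H]]] is controlled by [[[X, Y], H]] and
    [[[X, H], Y]]. *)
Lemma lcs_comm K H a b : is_normal K -> is_normal H ->
  comm_subgroup (lcs K H a) (lcs H H b) `<=` lcs K H (a + b).+1.
Proof.
move=> nK nH; elim: b a => [|b IHb] a; first by rewrite addn0.
have nX c := lcs_normal c nK nH; have nHb := lcs_normal b nH nH.
rewrite comm_subgroupC lcsS.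
apply: (three_subgroups (A := H) (B := lcs K H a)) => //.
- rewrite (comm_subgroupC H) -lcsS addnS -addSn; exact: IHb.
- rewrite addnS [lcs _ _ (_.+1)]lcsS; apply: comm_subgroupS => //; exact: IHb.
Qed.

(** A set of elements rather than a subgroup: the values of a lower central
    word have this form. *)
Definition left_normed X Y (c : nat) : set G :=
  iter c (fun Z => [set z | exists x y, [/\ Z x, Y y & z = [~ x, y]]]) X.

Definition conj_stable X := forall x g, X x -> X (x ^ g).

Lemma left_normed_stable X Y c :
  conj_stable X -> conj_stable Y -> conj_stable (left_normed X Y c).
Proof.
move=> sX sY; elim: c => //= c IHc _ g [x [y [Zx Yy ->]]].
by exists (x ^ g), (y ^ g); rewrite conjRg; split=> //; [exact: IHc|exact: sY].
Qed.

(** The commutators of generators generate, as soon as the generating sets are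
    stable under conjugation: they then generate a normal subgroup. *)
Lemma lcs_generated X Y c : conj_stable X -> conj_stable Y ->
  lcs (generated X) (generated Y) c = generated (left_normed X Y c).
Proof.
move=> sX sY; elim: c => //= c ->.
apply/seteqP; split.
  apply: comm_generated_sub => [|x y Xx Yy].
    exact/generated_normal/(@left_normed_stable _ _ c.+1).
  by apply: sub_generated; exists x, y.
apply: generated_sub (comm_subgroup_subgroup _ _) _ => _ [x [y [Xx Yy ->]]].
by apply: mem_comm_subgroup; apply: sub_generated.
Qed.

(** Modulo [lcs K H c.+1] the correction [z^-1 * z'] commutes with [H], and the
    correction [h^-1 * h'] commutes with [lcs H H c]; so both drop out of the
    commutator. *)
Lemma comm_congr K H c z z' h h' :
  is_normal K -> is_normal H -> K `<=` H ->
  lcs H H c z -> lcs K H c (z^-1 * z') -> H h -> K (h^-1 * h') ->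
  lcs K H c.+1 ([~ z, h]^-1 * [~ z', h']).
Proof.
move=> nK nH sKH zc; set k := z^-1 * z' => kc Hh; set k' := h^-1 * h' => Kk'.
have nN := lcs_normal c.+1 nK nH.
pose p := coset_of (NormalSubgroup nN).
have -> : z' = z * k by rewrite mulVKg.
have -> : h' = h * k' by rewrite mulVKg.
clearbody k k'.
have pM u v : p (u * v) = p u * p v by exact: gmulfM.
have pV u : p u^-1 = (p u)^-1 by exact: gmulfV.
have pR u v : p [~ u, v] = [~ p u, p v] by exact: gmulfR.
have kH u : H u -> commute (p k) (p u).
  by move=> Hu; apply/(coset_commute nN); exact: mem_comm_subgroup.
have k'z u : lcs H H c u -> commute (p k') (p u).
  move=> cu; apply/(coset_commute nN).
  by apply: (@lcs_comm _ _ 0 c nK nH); exact: mem_comm_subgroup.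
have nHc := lcs_normal c nH nH.
have czh : commute (p k') (p z ^ p h).
  by have := k'z (z ^ h) (nHc.2 _ _ zc); rewrite /p gmulfJ.
have cR : commute (p k) [~ p z, p h].
  rewrite /p -gmulfR; apply: kH.
  exact: (lcsW nH nH (leq0n c.+1) (mem_comm_subgroup zc Hh)).
have ck : commute (p k) (p h * p k').
  by apply: commuteM; apply: kH => //; exact: sKH.
apply/(coset_eq1P nN); rewrite -/(p _) pM pV !pR !pM.
apply: (mulgI [~ p z, p h]); rewrite mulVKg mulg1.
rewrite commgEl conjMg.
have -> : p k ^ (p h * p k') = p k by apply/conjg_fixP/commgP.
rewrite conjgM.
have -> : (p z ^ p h) ^ p k' = p z ^ p h.
  by apply/conjg_fixP/commgP/commute_sym.
by rewrite invgM -mulgA [(p z)^-1 * _]mulgA -commgEl -cR mulKg.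
Qed.

End Commutators.

(** * Free abelian sections *)

Section MultOn.
Local Open Scope classical_set_scope.
Local Open Scope group_scope.
Variables (G1 G2 : groupType).
Implicit Types (A H K : set G1) (f : G1 -> G2).

Definition mult_on A f := forall x y, A x -> A y -> f (x * y) = f x * f y.

Lemma mult_on1 A f : is_subgroup A -> mult_on A f -> f 1 = 1.
Proof. by move=> sA fM; apply: (mulgI (f 1)); rewrite -fM ?mulg1 //; exact: sA.1. Qed.

Lemma mult_onV A f x :
  is_subgroup A -> mult_on A f -> A x -> f x^-1 = (f x)^-1.
Proof.
move=> sA fM Ax; apply: (mulgI (f x)).
rewrite -fM ?mulgV ?(mult_on1 sA fM) //; exact: subgroupV.
Qed.

Lemma mult_onF A f x y :
  is_subgroup A -> mult_on A f -> A x -> A y -> f (x / y) = f x / f y.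
Proof.
by move=> sA fM Ax Ay; rewrite fM ?(mult_onV sA fM) //; exact: subgroupV.
Qed.

Lemma mult_onR A f x y : is_subgroup A -> mult_on A f -> A x -> A y ->
  f [~ x, y] = [~ f x, f y].
Proof.
move=> sA fM Ax Ay; have AM := subgroupM sA; have AV := subgroupV sA.
by rewrite /commg /conjg !fM ?(mult_onV sA fM) //; auto.
Qed.

Lemma mult_on_prod A f (r : nat) (F : 'I_r -> G1) :
  is_subgroup A -> mult_on A f -> (forall i, A (F i)) ->
  A (\prod_(i < r) F i) /\ f (\prod_(i < r) F i) = \prod_(i < r) f (F i).
Proof.
move=> sA fM AF; apply: (big_rec2 (fun x y => A x /\ f x = y)).
  by split; [exact: sA.1 | exact: mult_on1 sA fM].
by move=> i y x _ [Ax fx]; split; [exact: subgroupM | rewrite fM // fx].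
Qed.

Lemma mult_on_zpow A f x (z : int) : is_subgroup A -> mult_on A f -> A x ->
  A (zpow x z) /\ f (zpow x z) = zpow (f x) z.
Proof.
move=> sA fM Ax.
have X n : A (x ^+ n) /\ f (x ^+ n) = f x ^+ n.
  elim: n => [|n [IHA IHf]].
    by rewrite !expg0; split; [exact: sA.1 | exact: mult_on1 sA fM].
  by rewrite !expgS; split; [exact: subgroupM | rewrite fM // IHf].
case: z => n; rewrite /zpow; first exact: X.
have [Xn fXn] := X n.+1.
by split; [exact: subgroupV | rewrite (mult_onV sA fM) // fXn].
Qed.

End MultOn.

Section Prod.
Local Open Scope classical_set_scope.
Local Open Scope group_scope.

Lemma mult_onW (G1 G2 : groupType) (f : {multiplicative G1 -> G2}) A : mult_on A f.
Proof. by move=> x y _ _; exact: gmulfM. Qed.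

Lemma subgroup_prod (G : groupType) (A : set G) r (F : 'I_r -> G) :
  is_subgroup A -> (forall i, A (F i)) -> A (\prod_(i < r) F i).
Proof. by move=> sA AF; case: (@mult_on_prod _ _ A id _ F sA). Qed.

Lemma subgroup_zpow (G : groupType) (A : set G) x (z : int) :
  is_subgroup A -> A x -> A (zpow x z).
Proof. by move=> sA Ax; case: (@mult_on_zpow _ _ A id x z sA). Qed.

End Prod.

Section FreeAbelianSection.
Local Open Scope classical_set_scope.
Local Open Scope group_scope.
Variables (G : groupType).
Implicit Types (A B C : set G).

(** The quotient [A / B] of subgroups of [G] is free abelian of rank [r]. The
    witness is a function on all of [G], constrained on [A] only, so that
    neither subgroup types nor quotient types are needed. *)
Definition fa_section A B (r : nat) := exists phi : G -> free_abelian r,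
  [/\ mult_on A phi, forall v, exists2 x, A x & phi x = v
    & forall x, A x -> phi x = 1 <-> B x].

Definition zcomb (r : nat) (e : 'I_r -> G) (v : 'rV[int]_r) : G :=
  \prod_(i < r) zpow (e i) (v ord0 i).

Lemma zcomb_in A r (e : 'I_r -> G) v :
  is_subgroup A -> (forall i, A (e i)) -> A (zcomb e v).
Proof.
by move=> sA Ae; apply: subgroup_prod => // i; exact: subgroup_zpow.
Qed.

Lemma zcomb_delta r (e : 'I_r -> G) i : zcomb e (delta_mx ord0 i) = e i.
Proof.
rewrite /zcomb -[RHS](@expg1 _ (e i)).
have -> : e i ^+ 1 = \prod_(j < r | j == i) e j by rewrite big_pred1_eq.
rewrite [RHS]big_mkcond; apply: eq_bigr => j _.
by rewrite mxE eqxx /=; case: eqP => // ->; rewrite -[RHS]expg1.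
Qed.

(** Modulo [B], the map [zcomb e] is a homomorphism, as [A / B] is abelian; it is
    onto by generation and injective by independence. The witness is its
    inverse. *)
Lemma fa_section_of_basis A B r (e : 'I_r -> G) :
  is_subgroup A -> is_normal B -> B `<=` A -> comm_subgroup A A `<=` B ->
  (forall i, A (e i)) -> A `<=` generated (range e `|` B) ->
  (forall v, B (zcomb e v) -> v = 0%R) ->
  fa_section A B r.
Proof.
move=> sA nB sBA cAB Ae genA indep.
pose p := coset_of (NormalSubgroup nB).
have pM x y : p (x * y) = p x * p y by exact: gmulfM.
have p1 : p 1 = 1 by exact: gmorph1.
have sT := subgroup_setT G.
have pA x y : A x -> A y -> commute (p x) (p y).
  by move=> Ax Ay; apply/(coset_commute nB)/cAB; exact: mem_comm_subgroup.
have Azp i (z : int) : A (zpow (e i) z) by exact: subgroup_zpow.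
have Az v := zcomb_in v sA Ae.
have pzD (v w : 'rV[int]_r) : p (zcomb e (v + w)%R) = p (zcomb e v) * p (zcomb e w).
  have pzE u : p (zcomb e u) = \prod_(i < r) p (zpow (e i) (u ord0 i)).
    exact: (mult_on_prod sT (fun x y _ _ => pM x y) (fun=> I)).2.
  rewrite !pzE -prodgM_commute => [|i j _ _]; last by apply: pA; exact: Azp.
  apply: eq_bigr => i _; rewrite -pM; congr (p _).
  by rewrite mxE; exact: (zpow_morph (e i) (v ord0 i) (w ord0 i)).
have pz0 : p (zcomb e 0%R) = 1.
  by apply: (mulgI (p (zcomb e 0%R))); rewrite -pzD GRing.addr0 mulg1.
have pzN v : p (zcomb e (- v)%R) = (p (zcomb e v))^-1.
  by apply: (mulgI (p (zcomb e v))); rewrite -pzD GRing.addrN mulgV.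
have pV x : p x^-1 = (p x)^-1 by exact: gmulfV.
have ex x : exists v, A x -> p x = p (zcomb e v).
  have [Ax|nAx] := pselect (A x); last by exists 0%R.
  suff: [set x | exists v, p x = p (zcomb e v)] x by case=> v; exists v.
  move: x Ax; apply: subset_trans genA _; apply: generated_sub.
    split=> [|x y /= [v xv] [w yw]]; first by exists 0%R; rewrite pz0.
    by exists (v - w)%R; rewrite pzD pzN pM pV xv yw.
  move=> x [[i _ <-]|Bx]; first by exists (delta_mx ord0 i); rewrite zcomb_delta.
  by exists 0%R; rewrite pz0; apply/(coset_eq1P nB).
have [phi phiE] := choice ex.
have inj v w : p (zcomb e v) = p (zcomb e w) -> v = w.
  move=> vw; apply/eqP; rewrite -GRing.subr_eq0; apply/eqP/indep/(coset_eq1P nB).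
  by rewrite -/(p _) pzD pzN vw mulgV.
exists phi; split=> [x y Ax Ay|v|x Ax].
- by apply: inj; rewrite pzD -!phiE ?pM //; exact: subgroupM.
- by exists (zcomb e v) => //; apply: inj; rewrite -phiE.
- rewrite -(coset_eq1P nB) -/(p _) phiE //; split=> [-> //|].
  by rewrite -pz0 => /inj.
Qed.

Lemma zcomb_free_abelian r (v : 'rV[int]_r) :
  \prod_(i < r) zpow (delta_mx ord0 i : free_abelian r) (v ord0 i) = v.
Proof.
have zE (x : free_abelian r) (z : int) : zpow x z = ((x : 'rV[int]_r) *~ z)%R.
  have XE n : x ^+ n = ((x : 'rV[int]_r) *+ n)%R.
    by elim: n => // n IHn; rewrite expgS IHn GRing.mulrS.
  by case: z => n; rewrite /zpow XE.
rewrite [RHS](row_sum_delta v).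
have -> : (\sum_(j < r) v ord0 j *: (delta_mx ord0 j : 'rV[int]_r))%R
    = \prod_(j < r) ((v ord0 j *: (delta_mx ord0 j : 'rV[int]_r))%R : free_abelian r).
  by [].
by apply: eq_bigr => i _; rewrite zE -scaler_int intz.
Qed.

Lemma fa_section_basis A B r : is_subgroup A -> is_subgroup B -> B `<=` A ->
  fa_section A B r -> exists e : 'I_r -> G,
  [/\ forall i, A (e i), A `<=` generated (range e `|` B)
    & forall v, B (zcomb e v) -> v = 0%R].
Proof.
move=> sA sB sBA [phi [phiM phi_onto phiK]].
have ex (i : 'I_r) : exists x, A x /\ phi x = (delta_mx ord0 i : 'rV[int]_r).
  by have [x] := phi_onto (delta_mx ord0 i); exists x.
have [e eP] := choice ex.
have Ae i := (eP i).1.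
have phiz v : phi (zcomb e v) = v.
  rewrite -[RHS](zcomb_free_abelian v).
  rewrite (mult_on_prod sA phiM _).2; last by move=> i; exact: subgroup_zpow.
  by apply: eq_bigr => i _; rewrite (mult_on_zpow _ sA phiM (Ae i)).2 (eP i).2.
exists e; split=> // [x Ax|v].
  have sg := generated_subgroup (range e `|` B).
  have -> : x = zcomb e (phi x) * ((zcomb e (phi x))^-1 * x) by rewrite mulVKg.
  apply: (subgroupM sg).
    by apply: (zcomb_in _ sg) => i; apply: sub_generated; left; exists i.
  apply: sub_generated; right.
  have Az := zcomb_in (phi x) sA Ae.
  apply/phiK; first by apply: subgroupM => //; exact: subgroupV.
  by rewrite phiM ?(mult_onV sA phiM) ?phiz ?mulVg //; exact: subgroupV.
by move=> Bz; rewrite -(phiz v); apply/phiK => //; exact: zcomb_in.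
Qed.

(** As [A / C] is abelian, bases of [A / B] and of [B / C] together form a
    basis. *)
Lemma fa_section_glue A B C r s :
  is_subgroup A -> is_subgroup B -> is_normal C -> C `<=` B -> B `<=` A ->
  comm_subgroup A A `<=` C ->
  fa_section A B r -> fa_section B C s -> fa_section A C (r + s).
Proof.
move=> sA sB nC sCB sBA cAC rAB /(fa_section_basis sB nC.1 sCB) [e' [Be' gB ie']].
have [e [Ae gA ie]] := fa_section_basis sA sB sBA rAB.
pose f (i : 'I_(r + s)) := match split i with inl j => e j | inr j => e' j end.
have fl j : f (lshift s j) = e j by rewrite /f -/(unsplit (inl j)) unsplitK.
have fr j : f (rshift r j) = e' j by rewrite /f -/(unsplit (inr j)) unsplitK.
apply: (@fa_section_of_basis _ _ _ f) => //.
- exact: subset_trans sBA.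
- by move=> i; rewrite /f; case: split => j //; apply: sBA.
- have sg := generated_subgroup (range f `|` C).
  apply: (subset_trans gA); apply: (generated_sub sg) => x [[i _ <-]|Bx].
    by apply: sub_generated; left; exists (lshift s i).
  move: x Bx; apply: (subset_trans gB); apply: (generated_sub sg) => x.
  move=> [[i _ <-]|Cx]; last by apply: sub_generated; right.
  by apply: sub_generated; left; exists (rshift r i).
- move=> v; rewrite /zcomb big_split_ord /=.
  pose vl : 'rV_r := lsubmx v; pose vr : 'rV_s := rsubmx v.
  have -> : \prod_(i < r) zpow (f (lshift s i)) (v ord0 (lshift s i)) = zcomb e vl.
    by apply: eq_bigr => i _; rewrite fl mxE.
  have -> : \prod_(i < s) zpow (f (rshift r i)) (v ord0 (rshift r i)) = zcomb e' vr.
    by apply: eq_bigr => i _; rewrite fr mxE.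
  move=> Cz; have vl0 : vl = 0%R.
    apply: ie; rewrite -[zcomb e vl](mulgK (zcomb e' vr)).
    by apply: sB.2; [exact: sCB | exact: zcomb_in].
  have z0 : zcomb e vl = 1.
    by rewrite vl0 /zcomb; apply: big1 => i _; rewrite mxE.
  have vr0 : vr = 0%R by apply: ie'; rewrite z0 mul1g in Cz.
  by rewrite -(hsubmxK v) -/vl -/vr vl0 vr0 row_mx0.
Qed.

End FreeAbelianSection.

Section Transfer.
Local Open Scope classical_set_scope.
Local Open Scope group_scope.
Variables (G1 G2 : groupType).

Lemma fa_section_transfer (A B : set G1) (A2 B2 : set G2) alpha beta r :
  is_subgroup A -> is_subgroup B -> is_subgroup A2 -> is_subgroup B2 ->
  B2 `<=` A2 -> mult_on A alpha ->
  (forall x, A x -> A2 (alpha x)) -> (forall y, A2 y -> A (beta y)) ->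
  (forall x, B x -> B2 (alpha x)) -> (forall y, B2 y -> B (beta y)) ->
  (forall x, A x -> B (x^-1 * beta (alpha x))) ->
  (forall y, A2 y -> B2 (y^-1 * alpha (beta y))) ->
  fa_section A2 B2 r -> fa_section A B r.
Proof.
move=> sA sB sA2 sB2 sBA2 aM aA bA aB bB ba ab [phi [phiM phi_onto phiK]].
exists (phi \o alpha); split=> [x y Ax Ay|v|x Ax] /=.
- by rewrite aM // phiM //; apply: aA.
- have [y A2y <-] := phi_onto v; exists (beta y); first exact: bA.
  have abA := sBA2 _ (ab _ A2y).
  by rewrite -[alpha _](mulVKg y) phiM // (phiK _ abA).2 ?mulg1 //; exact: ab.
- rewrite phiK; last exact: aA.
  split=> [/bB Bba|]; last exact: aB.
  have -> : x = beta (alpha x) / (x^-1 * beta (alpha x)).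
    by rewrite invgM invgK mulVKg.
  by apply: sB.2 => //; exact: ba.
Qed.

Lemma lcs_image (H K : set G1) (H2 K2 : set G2) f c :
  is_normal H -> is_normal K -> K `<=` H -> mult_on H f ->
  (forall x, H x -> H2 (f x)) -> (forall x, K x -> K2 (f x)) ->
  forall x, lcs K H c x -> lcs K2 H2 c (f x).
Proof.
move=> nH nK sKH fM fH fK; elim: c => //= c IHc.
have nKc := lcs_normal c nK nH.
have sKc : lcs K H c `<=` H by apply: subset_trans sKH; exact: (lcsW nK nH (leq0n c)).
suff: comm_subgroup (lcs K H c) H `<=`
    [set x | H x /\ comm_subgroup (lcs K2 H2 c) H2 (f x)].
  by move=> sub x /sub [].
have sc := comm_subgroup_subgroup (lcs K2 H2 c) H2.
apply: comm_subgroup_sub.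
  split=> [|x y [Hx fx] [Hy fy]] /=.
    by rewrite (mult_on1 nH.1 fM); split; [exact: nH.1.1 | exact: sc.1].
  by rewrite (mult_onF nH.1 fM) //; split; [exact: nH.1.2 | exact: sc.2].
move=> x y Kx Hy; have Hx := sKc _ Kx; split.
  by rewrite commgEl; exact: (subgroupM nH.1 (subgroupV nH.1 Hx) (nH.2 _ _ Hx)).
by rewrite (mult_onR nH.1 fM) //; apply: mem_comm_subgroup; [exact: IHc|exact: fH].
Qed.

End Transfer.

Section SelfMaps.
Local Open Scope classical_set_scope.
Local Open Scope group_scope.

(** Changing the entries of a commutator of elements of [H] by factors in [K]
    changes it by a factor in [lcs K H c], by [comm_congr]. *)
Lemma lcs_congr (G : groupType) (H K : set G) u c :
  is_normal H -> is_normal K -> K `<=` H -> mult_on H u ->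
  (forall x, H x -> K (x^-1 * u x)) ->
  forall x, lcs H H c x -> lcs K H c (x^-1 * u x).
Proof.
move=> nH nK sKH uM uK; elim: c => //= c IHc.
have nKc := lcs_normal c.+1 nK nH.
have sHc : lcs H H c `<=` H by exact: (lcsW nH nH (leq0n c)).
pose p := coset_of (NormalSubgroup nKc).
have pE x y : p x = p y <-> lcs K H c.+1 (x^-1 * y) by exact: coset_ofP.
have pF x y : p (x / y) = p x / p y by exact: gmulfF.
suff: comm_subgroup (lcs H H c) H `<=` [set x | H x /\ p x = p (u x)].
  by move=> sub x /sub [_ /pE].
apply: comm_subgroup_sub.
  split=> [|x y [Hx ux] [Hy uy]] /=.
    by rewrite (mult_on1 nH.1 uM); split=> //; exact: nH.1.1.
  by rewrite (mult_onF nH.1 uM) // !pF ux uy; split=> //; exact: nH.1.2.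
move=> x y zx Hy; have Hx := sHc _ zx; split.
  by rewrite commgEl; exact: (subgroupM nH.1 (subgroupV nH.1 Hx) (nH.2 _ _ Hx)).
apply/pE; rewrite (mult_onR nH.1 uM) //.
by apply: comm_congr => //; [exact: IHc | exact: uK].
Qed.

(** The invariance of the Baer invariant in the case of lower central words:
    homomorphisms between [H1] and [H2] that are mutually inverse modulo [K1]
    and [K2] are mutually inverse on the derived sections. *)
Lemma fa_section_lcs (G1 G2 : groupType) (H1 K1 : set G1) (H2 K2 : set G2)
    (alpha : G1 -> G2) (beta : G2 -> G1) c r :
  is_normal H1 -> is_normal K1 -> K1 `<=` H1 ->
  is_normal H2 -> is_normal K2 -> K2 `<=` H2 ->
  mult_on H1 alpha -> mult_on H2 beta ->
  (forall x, H1 x -> H2 (alpha x)) -> (forall y, H2 y -> H1 (beta y)) ->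
  (forall x, K1 x -> K2 (alpha x)) -> (forall y, K2 y -> K1 (beta y)) ->
  (forall x, H1 x -> K1 (x^-1 * beta (alpha x))) ->
  (forall y, H2 y -> K2 (y^-1 * alpha (beta y))) ->
  fa_section (lcs H2 H2 c) (lcs K2 H2 c) r ->
  fa_section (lcs H1 H1 c) (lcs K1 H1 c) r.
Proof.
move=> nH1 nK1 sKH1 nH2 nK2 sKH2 aM bM aH bH aK bK ba ab.
have sH1 : lcs H1 H1 c `<=` H1 by exact: (lcsW nH1 nH1 (leq0n c)).
apply: (@fa_section_transfer _ _ _ _ _ _ alpha beta).
- exact: (lcs_normal c nH1 nH1).1.
- exact: (lcs_normal c nK1 nH1).1.
- exact: (lcs_normal c nH2 nH2).1.
- exact: (lcs_normal c nK2 nH2).1.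
- exact: lcs_monol.
- by move=> x y /sH1 Hx /sH1 Hy; exact: aM.
- exact: lcs_image.
- exact: lcs_image.
- exact: lcs_image.
- exact: lcs_image.
- apply: (@lcs_congr _ H1 K1 (beta \o alpha)) => // x y Hx Hy /=.
  by rewrite aM // bM //; exact: aH.
- apply: (@lcs_congr _ H2 K2 (alpha \o beta)) => // x y Hx Hy /=.
  by rewrite bM // aM //; exact: bH.
Qed.

End SelfMaps.

(** * Subgroups of free groups are projective *)

Section Wreath.
Local Open Scope classical_set_scope.
Local Open Scope group_scope.
Variables (F B : groupType).

Definition rtranslate (S : set F) (g : F) : set F := [set x | S (x / g)].

Lemma rtranslate1 S : rtranslate S 1 = S.
Proof. by apply/seteqP; split=> x; rewrite /rtranslate /= divg1. Qed.

Lemma rtranslateM S g h : rtranslate (rtranslate S g) h = rtranslate S (g * h).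
Proof. by apply/seteqP; split=> x; rewrite /rtranslate /= invgM mulgA. Qed.

(** The wreath product of [B] by [F], where [F] translates all its subsets. The
    cosets of any subgroup are among these subsets, so that one construction
    serves all subgroups without a type of cosets. *)
Definition wreath : Type := ((set F -> B) * F)%type.
HB.instance Definition _ := gen_eqMixin wreath.
HB.instance Definition _ := gen_choiceMixin wreath.

Definition wreath_one : wreath := (fun=> 1, 1).
Definition wreath_mul (a b : wreath) : wreath :=
  (fun S => a.1 S * b.1 (rtranslate S a.2), a.2 * b.2).
Definition wreath_inv (a : wreath) : wreath :=
  (fun S => (a.1 (rtranslate S a.2^-1))^-1, a.2^-1).

Fact wreath_mulA : associative wreath_mul.
Proof.
move=> [f g] [f' g'] [f'' g'']; rewrite /wreath_mul /= mulgA; congr pair.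
by apply/funext => S; rewrite mulgA rtranslateM.
Qed.

Fact wreath_mul1 : left_id wreath_one wreath_mul.
Proof.
move=> [f g]; rewrite /wreath_mul /= mul1g; congr pair.
by apply/funext => S; rewrite mul1g rtranslate1.
Qed.

Fact wreath_mulr1 : right_id wreath_one wreath_mul.
Proof.
move=> [f g]; rewrite /wreath_mul /= mulg1; congr pair.
by apply/funext => S; rewrite mulg1.
Qed.

Fact wreath_mulV : left_inverse wreath_one wreath_inv wreath_mul.
Proof.
move=> [f g]; rewrite /wreath_mul /= mulVg; congr pair.
by apply/funext => S; rewrite mulVg.
Qed.

Fact wreath_mulrV : right_inverse wreath_one wreath_inv wreath_mul.
Proof.
move=> [f g]; rewrite /wreath_mul /= mulgV; congr pair.
by apply/funext => S; rewrite rtranslateM mulgV rtranslate1 mulgV.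
Qed.

HB.instance Definition _ := isGroup.Build wreath wreath_mulA wreath_mul1
  wreath_mulr1 wreath_mulV wreath_mulrV.

End Wreath.

Section Projective.
Local Open Scope classical_set_scope.
Local Open Scope group_scope.

Definition hom_of (G H : groupType) (f : G -> H) (fM : {morph f : x y / x * y}) :
  {multiplicative G -> H} := HB.pack f (isMultiplicative.Build G H f fM).

Definition projective_on (F : groupType) (A : set F) :=
  forall (B C : groupType) (p : {multiplicative B -> C}) (phi : F -> C),
  (forall c, exists b, p b = c) -> mult_on A phi ->
  exists psi : F -> B, mult_on A psi /\ forall x, A x -> p (psi x) = phi x.

Lemma free_projective (F : groupType) : is_free F -> projective_on [set: F].
Proof.
move=> [X [b bP]] B C p phi p_onto phiM.
have [s sK] := choice p_onto.
have [psi [psib _]] := bP B (s \o phi \o b).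
have [theta [_ theta_uniq]] := bP C (phi \o b).
exists psi; split=> [x y _ _|x _]; first exact: gmulfM.
pose ppsi : {multiplicative F -> C} := p \o psi.
pose phi' : {multiplicative F -> C} := hom_of (fun x y => phiM x y I I).
have -> : phi x = theta x by apply: (theta_uniq phi').
by apply: (theta_uniq ppsi) => {}x /=; rewrite psib /= sK.
Qed.

(** A homomorphism from [H] to [C] induces one from [F] to the wreath product of
    [C] by [F]: the coordinate of [g] at a coset is the image of the element of
    [H] by which [g] fails to preserve a transversal. This induced homomorphism
    lifts to the wreath product of [B], and the coordinate of the lift at the
    coset [H] itself, which [H] fixes, is the desired lift on [H]. *)
Lemma subgroup_projective (F : groupType) (H : set F) :
  projective_on [set: F] -> is_subgroup H -> projective_on H.
Proof.
move=> projF sH B C p phi p_onto phiM.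
have tH x : H x -> rtranslate H x = H.
  move=> Hx; apply/seteqP; split=> y /= Hy; last exact: sH.2.
  by rewrite -[y](mulgVK x); apply: subgroupM.
pose coset S := exists x, S = rtranslate H x.
have cosetM S g : coset (rtranslate S g) <-> coset S.
  split=> -[x Sx]; last by exists (x * g); rewrite Sx rtranslateM.
  by exists (x / g); rewrite -rtranslateM -Sx rtranslateM mulgV rtranslate1.
(* a transversal, normalized to represent H by 1 *)
have exr S : exists x, (S = H -> x = 1) /\ (coset S -> S = rtranslate H x).
  have [->|nSH] := pselect (S = H).
    by exists 1; split=> // _; rewrite rtranslate1.
  have [[x Sx]|nS] := pselect (coset S); first by exists x.
  by exists 1; split.
have [r rP] := choice exr.
pose h S g := r S * g / r (rtranslate S g).
have hH S g : coset S -> H (h S g).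
  move=> cS; have cSg : coset (rtranslate S g) by apply/cosetM.
  have : rtranslate S g (r (rtranslate S g)).
    by rewrite {1}((rP _).2 cSg) /rtranslate /= mulgV; exact: sH.1.
  rewrite {1}((rP _).2 cS) rtranslateM /rtranslate /= => /(subgroupV sH).
  by rewrite invgM invgK.
pose th g : wreath F C := (fun S => if `[< coset S >] then phi (h S g) else 1, g).
have thM : {morph th : x y / x * y}.
  move=> x y; congr pair; apply/funext => S /=.
  case: asboolP => cS; last first.
    by case: asboolP => [/cosetM//|_]; rewrite mulg1.
  have cSx : coset (rtranslate S x) by apply/cosetM.
  case: asboolP => // _; rewrite -phiM; [|exact: hH..]; congr phi.
  by rewrite /h !rtranslateM -!mulgA mulKg.
pose Pi (a : wreath F B) : wreath F C := (p \o a.1, a.2).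
have PiM : {morph Pi : x y / x * y}.
  by move=> [f g] [f' g']; congr pair; apply/funext => S /=; exact: gmulfM.
have Pi_onto (c : wreath F C) : exists b : wreath F B, Pi b = c.
  have [s sK] := choice p_onto; exists (s \o c.1, c.2).
  by case: c => f g; congr pair; apply/funext => S /=.
have [psi [psiM psiE]] := projF _ _ (hom_of PiM) th Pi_onto (fun x y _ _ => thM x y).
have psi2 x : (psi x).2 = x by have /(congr1 snd) := psiE x I.
exists (fun x => (psi x).1 H); split=> [x y Hx Hy|x Hx].
  by rewrite psiM //= psi2 tH.
have /(congr1 (fun c : wreath F C => c.1 H)) /= -> := psiE x I.
case: asboolP => [_|[]]; last by exists 1; rewrite rtranslate1.
by rewrite /h tH // (rP H).1 // mul1g divg1.
Qed.

End Projective.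

(** * Polynilpotent words *)

Section Words.
Local Open Scope classical_set_scope.
Local Open Scope group_scope.
Variable G : groupType.
Implicit Types (f v : nat -> G) (w : word) (P X Y H K R : set G).

Lemma word_eval_subst f s w :
  word_eval f (word_subst s w) = word_eval (fun i => word_eval f (s i)) w.
Proof. by elim: w => //= [u -> v ->|u ->]. Qed.

Definition iter_comm v (c : nat) : G :=
  foldl (fun x y => [~ x, y]) (v 0) [seq v i | i <- iota 1 c].

Lemma iter_commS v c : iter_comm v c.+1 = [~ iter_comm v c, v c.+1].
Proof.
have -> : iter_comm v c.+1 = foldl (fun x y => [~ x, y]) (v 0)
    [seq v i | i <- iota 1 c ++ iota (1 + c) 1] by rewrite -iotaD addn1.
by rewrite map_cat foldl_cat.
Qed.

Lemma eq_iter_comm v v' c :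
  (forall i, i <= c -> v i = v' i) -> iter_comm v c = iter_comm v' c.
Proof.
elim: c => [|c IHc] vv'; first exact: vv'.
rewrite !iter_commS IHc ?vv' // => i ic; apply: vv'; exact: leqW.
Qed.

Lemma word_eval_gamma f c : word_eval f (gamma_word c.+1) = iter_comm f c.
Proof.
rewrite /gamma_word /iter_comm /= -[f 0]/(word_eval f (WVar 0)).
by elim: (iota 1 c) (WVar 0) => //= i s IHs u; rewrite IHs.
Qed.

Lemma word_eval_step f w k c : word_eval f (polynilpotent_step (w, k) c).1 =
  iter_comm (fun i => word_eval (fun j => f (i * k + j)%N) w) c.
Proof.
rewrite /= word_eval_subst word_eval_gamma; apply: eq_iter_comm => i _.
exact: word_eval_subst.
Qed.

Definition word_bounded w (k : nat) := forall f f',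
  (forall i, i < k -> f i = f' i) -> word_eval f w = word_eval f' w.

Lemma gamma_bounded c : word_bounded (gamma_word c.+1) c.+1.
Proof. by move=> f f' ff'; rewrite !word_eval_gamma; apply: eq_iter_comm. Qed.

Lemma step_bounded w k c : word_bounded w k ->
  word_bounded (polynilpotent_step (w, k) c).1 (polynilpotent_step (w, k) c).2.
Proof.
move=> bw f f' ff'; rewrite !word_eval_step; apply: eq_iter_comm => i ic.
apply: bw => j jk; apply: ff'; rewrite /= mulSn.
have : i * k <= c * k by rewrite leq_mul2r ic orbT.
by lia.
Qed.

(** With [P] a normal subgroup [R], these values turn out to generate the
    marginal commutator subgroup; with [P] the full set, the verbal one. *)
Definition word_values P w : set G :=
  [set z | exists f, P (f 0) /\ z = word_eval f w].

Lemma word_values_stable P w : conj_stable P -> conj_stable (word_values P w).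
Proof.
move=> sP _ g [f [Pf ->]]; exists (fun j => f j ^ g); rewrite word_evalJ.
by split=> //; exact: sP.
Qed.

Lemma left_normedP X Y c z : left_normed X Y c z <-> exists v,
  [/\ X (v 0), forall i, 0 < i <= c -> Y (v i) & z = iter_comm v c].
Proof.
elim: c z => [|c IHc] z /=.
  split=> [Xz|[v [Xv _ ->]] //].
  by exists (fun=> z); split=> // -[].
split=> [[x [y [/IHc [v [Xv Yv ->]] Yy ->]]]|[v [Xv Yv ->]]].
  exists (fun i => if i == c.+1 then y else v i); split=> // [i /andP[i0 ic]|].
    by case: eqP => // nic; apply: Yv; lia.
  rewrite iter_commS eqxx; congr [~ _, _]; apply: eq_iter_comm => i ic.
  by case: eqP => // ?; lia.
exists (iter_comm v c), (v c.+1); rewrite iter_commS; split=> //.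
  by apply/IHc; exists v; split=> // i ic; apply: Yv; lia.
by apply: Yv; rewrite leqnn.
Qed.

Lemma word_values_gamma P c :
  word_values P (gamma_word c.+1) = left_normed P setT c.
Proof.
apply/seteqP; split=> z.
  by move=> [f [Pf ->]]; apply/left_normedP; exists f; rewrite word_eval_gamma.
by move=> /left_normedP [f [Pf _ ->]]; exists f; rewrite word_eval_gamma.
Qed.

(** The copies of [w] use disjoint sets of variables, hence take their values
    independently of each other. *)
Lemma word_values_step P w k c : 0 < k -> word_bounded w k ->
  word_values P (polynilpotent_step (w, k) c).1
  = left_normed (word_values P w) (word_values setT w) c.
Proof.
move=> k0 bw; apply/seteqP; split=> z.
  move=> [f [Pf ->]]; rewrite word_eval_step; apply/left_normedP.
  eexists; split; last by [].
    by exists f; split=> //; congr word_eval; apply/funext => j; rewrite mul0n.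
  by move=> i _; eexists; split.
move=> /left_normedP [v [[f0 [Pf0 vf0]] Yv ->]].
have ex i : exists f, (i = 0 -> P (f 0)) /\ (i <= c -> v i = word_eval f w).
  case: i => [|i]; first by exists f0.
  have [ic|ic] := boolP (i < c); last by exists f0; split.
  by have [|f [_ vf]] := Yv i.+1; rewrite ?ic //; exists f.
have [g gP] := choice ex.
exists (fun n => g (n %/ k) (n %% k)); split.
  by rewrite div0n mod0n; exact: (gP 0).1.
rewrite word_eval_step; apply: eq_iter_comm => i ic; rewrite (gP i).2 //.
by apply: bw => j jk; rewrite divnMDl // divn_small // addn0 modnMDl modn_small.
Qed.

Definition series_step (KH : set G * set G) (c : nat) : set G * set G :=
  (lcs KH.1 KH.2 c, lcs KH.2 KH.2 c).

(** At the end of the class row, the first component is the marginal commutator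
    subgroup and the second one the verbal subgroup. *)
Definition polynilpotent_series R (cs : seq nat) : set G * set G :=
  foldl series_step (R, setT) cs.

Lemma generated_subgroup_id R : is_subgroup R -> generated R = R.
Proof.
move=> sR; apply/seteqP; split; last exact: sub_generated.
exact: generated_sub.
Qed.

(** Sets of word values are stable under conjugation, so [lcs_generated] turns
    each substitution step into one step of the series. *)
Lemma generated_word_values R c1 cs : is_normal R ->
  (generated (word_values R (polynilpotent_word c1 cs)),
   generated (word_values setT (polynilpotent_word c1 cs)))
  = polynilpotent_series R (c1 :: cs).
Proof.
move=> nR; rewrite /polynilpotent_word /polynilpotent_series /=.
have sT : conj_stable [set: G] by [].
have sR : conj_stable R := nR.2.
have : series_step (R, setT) c1 =
    (generated (word_values R (gamma_word c1.+1)),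
     generated (word_values setT (gamma_word c1.+1))).
  rewrite !word_values_gamma -!lcs_generated //.
  by rewrite (generated_subgroup_id nR.1) (generated_subgroup_id (subgroup_setT G)).
move=> ->; have : 0 < c1.+1 by [].
move: (gamma_bounded (c := c1)); move: c1.+1 (gamma_word c1.+1) => k w.
elim: cs k w => //= c cs IHcs k w bw k0.
have k'0 : 0 < c.+1 * k by rewrite muln_gt0.
have /= := IHcs _ _ (step_bounded (c := c) bw) k'0 => ->; congr foldl.
rewrite [RHS]/series_step /= -/(polynilpotent_step (w, k) c).
have -> : word_subst (fun i => word_subst (fun j => WVar (i * k + j)%N) w)
    (gamma_word c.+1) = (polynilpotent_step (w, k) c).1 by [].
rewrite !word_values_step // !lcs_generated //; exact: word_values_stable.
Qed.

Lemma word_eval1 c1 cs f : f 0 = 1 -> word_eval f (polynilpotent_word c1 cs) = 1.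
Proof.
have comm1 v c : v 0 = 1 -> iter_comm v c = 1.
  by move=> v1; elim: c => // c; rewrite iter_commS => ->; exact: comm1g.
have : forall f, f 0 = 1 -> word_eval f (gamma_word c1.+1) = 1.
  by move=> f' f1; rewrite word_eval_gamma comm1.
rewrite /polynilpotent_word; move: c1.+1 (gamma_word c1.+1) => k w.
move=> w1 f1; elim: cs w k w1 => [|c cs IHcs] w k w1; first exact: w1.
apply: IHcs => f' f'1; have /= -> := word_eval_step f' w k c.
by apply: comm1; apply: w1; rewrite mul0n.
Qed.

Lemma iter_comm_congr H K v v' c :
  is_normal H -> is_normal K -> K `<=` H ->
  (forall i, H (v i)) -> (forall i, K ((v i)^-1 * v' i)) ->
  lcs H H c (iter_comm v c) /\
  lcs K H c ((iter_comm v c)^-1 * iter_comm v' c).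
Proof.
move=> nH nK sKH Hv Kv; elim: c => [|c [IH1 IH2]].
  by split; [exact: Hv | exact: Kv].
by rewrite !iter_commS; split; [exact: mem_comm_subgroup | exact: comm_congr].
Qed.

Lemma series_normal R cs : is_normal R ->
  [/\ is_normal (polynilpotent_series R cs).1,
      is_normal (polynilpotent_series R cs).2
    & (polynilpotent_series R cs).1 `<=` (polynilpotent_series R cs).2].
Proof.
rewrite /polynilpotent_series => nR.
have : [/\ is_normal (R, [set: G]).1, is_normal (R, [set: G]).2
       & (R, [set: G]).1 `<=` (R, [set: G]).2] by split.
elim: cs (R, [set: G]) => //= c cs IHcs [K H] [/= nK nH sKH].
by apply: IHcs; split; [exact: lcs_normal | exact: lcs_normal | exact: lcs_monol].
Qed.

(** All variables may be changed modulo [R] at once: the single-variable changes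
    that define the marginal commutator subgroup are a special case. *)
Lemma word_eval_congr R c1 cs f f' : is_normal R ->
  (forall j, R ((f j)^-1 * f' j)) ->
  let w := polynilpotent_word c1 cs in
  (polynilpotent_series R (c1 :: cs)).1 ((word_eval f w)^-1 * word_eval f' w).
Proof.
move=> nR Rff'; rewrite /polynilpotent_word /polynilpotent_series /=.
pose good (KH : set G * set G) w := [/\ is_normal KH.1, is_normal KH.2, KH.1 `<=` KH.2
  & forall f f', (forall j, R ((f j)^-1 * f' j)) ->
    KH.2 (word_eval f w) /\ KH.1 ((word_eval f w)^-1 * word_eval f' w)].
have : good (series_step (R, setT) c1) (gamma_word c1.+1).
  split; rewrite /=;
    [exact: lcs_normal | exact: lcs_normal | exact: lcs_monol |].
  by move=> g g' Rg; rewrite !word_eval_gamma; apply: iter_comm_congr.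
move: c1.+1 (gamma_word c1.+1) (series_step _ _) => k w KH.
elim: cs k w KH => [|c cs IHcs] k w [K H] [/= nK nH sKH Kw].
  exact: (Kw _ _ Rff').2.
apply: IHcs; split; rewrite /=;
  [exact: lcs_normal | exact: lcs_normal | exact: lcs_monol |].
move=> g g' Rg; have /= -> := word_eval_step g w k c.
have /= -> := word_eval_step g' w k c.
apply: iter_comm_congr => // i; last exact: (Kw _ _ _).2.
by apply: (Kw _ (fun j => g' (i * k + j)%N) _).1.
Qed.

End Words.

Section VerbalMarginal.
Local Open Scope classical_set_scope.
Local Open Scope group_scope.
Variables (F : groupType) (R : normal_subgroup F) (c1 : nat) (cs : seq nat).

Lemma verbal_polynilpotent :
  @verbal_subgroup F (polynilpotent_laws c1 cs) =
  (polynilpotent_series R (c1 :: cs)).2.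
Proof.
rewrite -(generated_word_values c1 cs (normal_setP R)) /=; congr generated.
apply/seteqP; split=> z; first by move=> [_ [f [-> ->]]]; exists f.
by move=> [f [_ ->]]; exists (polynilpotent_word c1 cs), f.
Qed.

Lemma marginal_polynilpotent :
  marginal_commutator R (polynilpotent_laws c1 cs) =
  (polynilpotent_series R (c1 :: cs)).1.
Proof.
have nR := normal_setP R.
have [nK _ _] := series_normal (c1 :: cs) nR.
have nM := marginal_commutator_normal R (polynilpotent_laws c1 cs).
apply/seteqP; split.
  apply: (generated_sub nK.1) => _ [_ [f [i [r [-> Rr ->]]]]].
  set f' := fun j => _.
  have Rff' j : normal_set R ((f j)^-1 * f' j).
    by rewrite /f'; case: eqP => _; rewrite ?mulKg // mulVg; exact: nR.1.1.
  have /nK.2 := word_eval_congr c1 cs nR Rff'.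
  move=> /(_ (word_eval f (polynilpotent_word c1 cs))^-1).
  by rewrite /conjg invgK mulgA mulVKg.
rewrite -(generated_word_values c1 cs nR) /=.
(* a value with f 0 in R is the quotient of the values at f 0 = 1 * f 0 and at *)
(* 1, of which the second is trivial                                           *)
apply: (generated_sub nM.1) => _ [f [Rf ->]]; apply: sub_generated.
exists (polynilpotent_word c1 cs), (fun j => if j == 0 then 1 else f j), 0, (f 0).
split=> //; rewrite [X in _ / X]word_eval1 // divg1; congr word_eval.
by apply/funext => -[|j] //=; rewrite mul1g.
Qed.

End VerbalMarginal.

(** * Lyndon words *)

Section Lyndon.
Variable d : nat.
Notation word := (seq 'I_d).
Implicit Types (u v w s t : word).

Fixpoint lex u v : bool :=
  match u, v with
  | _, [::] => false
  | [::], _ :: _ => true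
  | a :: u', b :: v' => (a < b) || ((a == b) && lex u' v')
  end.

Lemma lex_irr u : lex u u = false.
Proof. by elim: u => //= a u ->; rewrite ltnn andbF. Qed.

Lemma lex_trans : transitive lex.
Proof.
elim=> [|b v IHv] [|a u] [|c w] //=.
move=> /orP[ab|/andP[/eqP-> uv]] /orP[bc|/andP[/eqP<- vw]].
- by rewrite (ltn_trans ab bc).
- by rewrite ab.
- by rewrite bc.
- by rewrite eqxx (IHv _ _ uv vw) orbT.
Qed.

Lemma lex_total u v : u != v -> lex u v || lex v u.
Proof.
elim: u v => [|a u IHu] [|b v] //=; rewrite eqseq_cons negb_and.
have [ab|ab|/val_inj ->] //= := ltngtP a b; rewrite ?orbT //.
by rewrite eqxx /=; exact: IHu.
Qed.

Lemma lex_asym u v : lex u v -> lex v u = false.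
Proof. by move=> uv; apply/negP => /(lex_trans uv); rewrite lex_irr. Qed.

Lemma lex_cat2l w u v : lex (w ++ u) (w ++ v) = lex u v.
Proof. by elim: w => //= a w ->; rewrite ltnn eqxx. Qed.

Lemma lex_cat u v : v != [::] -> lex u (u ++ v).
Proof. by move=> v0; rewrite -{1}[u]cats0 lex_cat2l; case: v v0. Qed.

(** In the second case the words differ at some position, which is not affected
    by what is appended. *)
Lemma lex_prefix_or u v : lex u v ->
  (exists2 s, s != [::] & v = u ++ s) \/ forall x y, lex (u ++ x) (v ++ y).
Proof.
elim: u v => [|a u IHu] [|b v] //=; first by left; exists (b :: v).
move=> /orP[ab|/andP[/eqP-> /IHu[[s s0 ->]|uv]]].
- by right=> x y; rewrite ab.
- by left; exists s.
- by right=> x y; rewrite eqxx uv orbT.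
Qed.

Lemma lex_catr u v x y : lex u v -> size v <= size u -> lex (u ++ x) (v ++ y).
Proof.
move=> /lex_prefix_or[[s s0 ->]|//]; rewrite size_cat.
by case: s s0 => //= b s _; lia.
Qed.

Definition lexle u v := (u == v) || lex u v.

Lemma lexle_refl u : lexle u u. Proof. by rewrite /lexle eqxx. Qed.

Lemma lexNle u v : ~~ lex u v = lexle v u.
Proof.
rewrite /lexle; case: eqVneq => [->|nvu]; first by rewrite lex_irr.
have := lex_total nvu; case vu: (lex v u) => /=; first by rewrite (lex_asym vu).
by move=> ->.
Qed.

Lemma lexle_lt_trans u v w : lexle u v -> lex v w -> lex u w.
Proof. by move=> /orP[/eqP->//|]; exact: lex_trans. Qed.

Lemma lex_le_trans u v w : lex u v -> lexle v w -> lex u w.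
Proof. by move=> uv /orP[/eqP<-//|]; apply: lex_trans. Qed.

Lemma lexle_trans u v w : lexle u v -> lexle v w -> lexle u w.
Proof.
move=> /orP[/eqP-> //|uv] vw; apply/orP; right; exact: lex_le_trans vw.
Qed.

Lemma lexle_anti u v : lexle u v -> lexle v u -> u = v.
Proof. by move=> /orP[/eqP//|uv] /(lex_le_trans uv); rewrite lex_irr. Qed.

Lemma lexle_cat2 u v x y : size u = size v ->
  lexle (u ++ x) (v ++ y) = lex u v || (u == v) && lexle x y.
Proof.
move=> uv; have [<-|nuv] /= := eqVneq u v.
  by rewrite lex_irr /lexle eqseq_cat // eqxx lex_cat2l.
rewrite orbF /lexle eqseq_cat // (negPf nuv) /=.
have := lex_total nuv; have [uv' _|_ /= vu] := boolP (lex u v).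
  by rewrite lex_catr // uv.
by rewrite lex_asym // lex_catr // uv.
Qed.

(** The characterization by suffixes suits factorizations; counting uses the
    one by rotations ([lyndon_rotP]). *)
Definition lyndon w :=
  (w != [::]) && all (fun i => lex w (drop i w)) (iota 1 (size w).-1).

Lemma lyndonP w : reflect
  (w != [::] /\ forall u v, w = u ++ v -> u != [::] -> v != [::] -> lex w v)
  (lyndon w).
Proof.
apply: (iffP andP) => -[w0 wP]; split=> //.
  move=> u v wuv u0 v0.
  have := allP wP (size u); rewrite [X in lex _ (drop _ X)]wuv drop_size_cat //.
  apply; rewrite mem_iota add1n wuv size_cat.
  by case: u v u0 v0 {wuv} => [|a u] [|b v] //= _ _; lia.
apply/allP => i; rewrite mem_iota; rewrite add1n ltnS => /andP[i0 iw].
have {}iw : i < size w.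
  by apply: leq_ltn_trans iw _; rewrite ltn_predL lt0n size_eq0.
apply: (wP (take i w)); first by rewrite cat_take_drop.
  by rewrite -size_eq0 size_takel -?lt0n // ltnW.
by rewrite -size_eq0 size_drop -lt0n subn_gt0.
Qed.

Lemma lyndon_nil w : lyndon w -> w != [::].
Proof. by case/andP. Qed.

Lemma lyndon_suffix u v : lyndon (u ++ v) -> u != [::] -> v != [::] ->
  lex (u ++ v) v.
Proof. by move=> /lyndonP[_ +] u0 v0; apply. Qed.

Lemma lyndon_cat_lt u v : lyndon u -> lyndon v -> lex u v -> lex (u ++ v) v.
Proof.
move=> /lyndon_nil u0 /lyndonP[v0 vP] uv.
case: (lex_prefix_or uv) => [[s s0 vE]|/(_ v [::])].
  by rewrite {2}vE lex_cat2l; exact: (vP _ _ vE u0 s0).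
by rewrite cats0.
Qed.

Lemma cat_eq_cat u v s t : u ++ v = s ++ t ->
  (exists x, s = u ++ x /\ v = x ++ t) \/ (exists x, u = s ++ x /\ t = x ++ v).
Proof.
elim: u s => [|a u IHu] [|b s] /=.
- by move=> <-; left; exists [::].
- by move=> ->; left; exists (b :: s).
- by move=> <-; right; exists (a :: u).
- case=> -> /IHu[[x [-> ->]]|[x [-> ->]]]; first by left; exists x.
  by right; exists x.
Qed.

Lemma cat_neq s t : s != [::] -> s ++ t != t.
Proof.
apply: contraNneq => /(congr1 size)/eqP.
by rewrite size_cat -{2}[size t]add0n eqn_add2r size_eq0.
Qed.

Lemma lyndon_cat u v : lyndon u -> lyndon v -> lex u v -> lyndon (u ++ v).
Proof.
move=> lu lv uv; have uvv := lyndon_cat_lt lu lv uv.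
have u0 := lyndon_nil lu; have v0 := lyndon_nil lv.
apply/lyndonP; split; first by case: u u0 {lu uv uvv}.
move=> s t /cat_eq_cat[[x [sE vE]]|[x [uE tE]]] s0 t0.
  have [x0|x0] := eqVneq x [::]; first by move: uvv; rewrite {2}vE x0.
  apply: (lex_trans uvv); rewrite vE; apply: lyndon_suffix => //; by rewrite -vE.
have [x0|x0] := eqVneq x [::]; first by rewrite tE x0.
rewrite tE; have /lex_catr : lex u x by rewrite {1}uE; apply: lyndon_suffix; rewrite -?uE.
by apply; rewrite uE size_cat; lia.
Qed.

Fixpoint minsuf w : word :=
  if w is a :: w' then
    if (w' == [::]) || lex w (minsuf w') then w else minsuf w'
  else [::].

Lemma minsufP w : w != [::] -> [/\ exists u, w = u ++ minsuf w, minsuf w != [::]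
  & forall u v, w = u ++ v -> v != [::] -> lexle (minsuf w) v].
Proof.
elim: w => // a w IHw _; 
have -> : minsuf (a :: w) =
  if (w == [::]) || lex (a :: w) (minsuf w) then a :: w else minsuf w by [].
have [->|w0] := eqVneq w [::].
  split=> // [|[|b u] v /=]; first by exists [::].
    by move=> <- _; exact: lexle_refl.
  by case: u => // -[_ <-].
have {IHw} [[u wE] m0 mP] := IHw w0.
have [lt|ge] := boolP (lex (a :: w) (minsuf w)).
  split=> // [|[|b t] v /=]; first by exists [::].
    by move=> <- _; exact: lexle_refl.
  by case=> _ wtv v0; apply/orP; right; apply: lex_le_trans lt _; exact: (mP _ _ wtv v0).
split=> // [|[|b t] v /=]; first by exists (a :: u); rewrite /= -wE.
  by move=> <- _; rewrite -lexNle.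
by case=> _ wtv v0; exact: (mP _ _ wtv v0).
Qed.

(** Cutting off the smallest proper suffix of a Lyndon word leaves two Lyndon
    words ([lyndon_std]): this is its standard factorization. *)
Definition std w : word * word :=
  let v := minsuf (behead w) in (take (size w - size v) w, v).

Lemma stdP w : 1 < size w ->
  [/\ w = (std w).1 ++ (std w).2, (std w).1 != [::], (std w).2 != [::]
    & forall s t, w = s ++ t -> s != [::] -> t != [::] -> lexle (std w).2 t].
Proof.
case: w => // a w; rewrite /std /behead => w1.
have w0 : w != [::] by rewrite -size_eq0 -lt0n.
have [[u wE] m0 mP] := minsufP w0.
have szw : size (a :: w) - size (minsuf w) = size (a :: u).
  by rewrite [in size (a :: w)]wE /= size_cat; lia.
have -> : take (size (a :: w) - size (minsuf w)) (a :: w) = a :: u.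
  by rewrite szw [in X in take _ X]wE /= take_size_cat.
split=> //; first by rewrite {1}wE.
by move=> [//|b s] t [_ wst] _; exact: (mP _ _ wst).
Qed.

Lemma std_unique u v : u != [::] -> v != [::] ->
  (forall s t, u ++ v = s ++ t -> s != [::] -> t != [::] -> lexle v t) ->
  std (u ++ v) = (u, v).
Proof.
move=> u0 v0 vP; have : 1 < size (u ++ v).
  by case: u v u0 v0 {vP} => [|a u] [|b v] // _ _; rewrite size_cat /=; lia.
move/stdP; case: (std _) => s t /= [E s0 t0 tP].
have tv : t = v by apply: lexle_anti; [apply: (tP u v) | apply: (vP s t)].
move: E; rewrite tv => E; congr pair.
have szs : size s = size u by move/(congr1 size): E; rewrite !size_cat => /addIn.
by apply/eqP; move/eqP: E; rewrite eq_sym eqseq_cat // => /andP[].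
Qed.

(** If [t] were a suffix of [u] with [t < u], comparing [w = u ++ v] with its
    suffix [t ++ v] would show that [u = t ++ x] and [x ++ v < v], against the
    choice of [v]. *)
Lemma lyndon_std w : lyndon w -> 1 < size w ->
  [/\ lyndon (std w).1, lyndon (std w).2 & lex (std w).1 (std w).2].
Proof.
move=> lw w1; move: (stdP w1); case: (std w) => u v /= [E u0 v0 vP].
have ltwv : lex w v by rewrite E; apply: lyndon_suffix; rewrite -?E.
split.
- apply/lyndonP; split=> // s t ust s0 t0; rewrite -[lex _ _]negbK lexNle.
  apply/negP => /orP[/eqP tu|tu].
    by move: (cat_neq t s0); rewrite -ust tu eqxx.
  have : lex w (t ++ v).
    rewrite E ust -catA; apply: lyndon_suffix => //; last by case: t t0 {ust tu}.
    by rewrite catA -ust -E.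
  rewrite {1}E => uvtv; case: (lex_prefix_or tu) => [[x x0 ux]|/(_ v v)].
    move: uvtv; rewrite ux -catA lex_cat2l => xvv.
    have := vP t (x ++ v); rewrite E ux -catA => /(_ erefl t0).
    have xv0 : x ++ v != [::] by case: x x0 {ux xvv}.
    by move=> /(_ xv0); rewrite -lexNle xvv.
  by rewrite (lex_asym uvtv).
- apply/lyndonP; split=> // s t vst s0 t0.
  have := vP (u ++ s) t; rewrite E vst catA => /(_ erefl).
  have us0 : u ++ s != [::] by case: u u0 {E vP}.
  move=> /(_ us0 t0); rewrite -vst => /orP[/eqP vt|//].
  by move: (cat_neq t s0); rewrite -vst vt eqxx.
- by apply: lex_trans ltwv; rewrite E; exact: lex_cat.
Qed.

(** This decides whether the commutator of the commutators attached to [u] and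
    [v] is the one attached to [u ++ v], or has to be rewritten. *)
Lemma std_cat u v : lyndon u -> lyndon v ->
  (1 < size u -> lexle v (std u).2) -> std (u ++ v) = (u, v).
Proof.
move=> lu lv u2v; have u0 := lyndon_nil lu; have v0 := lyndon_nil lv.
apply: std_unique => // s t /cat_eq_cat[[x [sE vE]]|[x [uE tE]]] s0 t0.
  have [x0|x0] := eqVneq x [::]; first by rewrite vE x0 lexle_refl.
  by apply/orP; right; rewrite vE; apply: lyndon_suffix; rewrite -?vE.
have [x0|x0] := eqVneq x [::]; first by rewrite tE x0 lexle_refl.
have u1 : 1 < size u.
  rewrite uE size_cat; case: s s0 {uE} => // a s _; case: x x0 {tE} => //= b x _.
  by lia.
move: (stdP u1) (u2v u1); case: (std u) => u1' u2 /= [_ _ _ /(_ s x uE s0 x0) u2x] vu2.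
apply/orP; right; rewrite tE; apply: lexle_lt_trans (lexle_trans vu2 u2x) _.
exact: lex_cat.
Qed.

End Lyndon.

(** * Counting Lyndon words *)

Section WordPowers.
Variable T : eqType.
Implicit Types (u v w l x : seq T).

Definition wpow (e : nat) w : seq T := flatten (nseq e w).

Lemma wpowS e w : wpow e.+1 w = w ++ wpow e w. Proof. by []. Qed.

Lemma size_wpow e w : size (wpow e w) = e * size w.
Proof. by elim: e => //= e IHe; rewrite size_cat IHe. Qed.

Lemma rot_wpow p e l : p <= size l -> rot p (wpow e l) = wpow e (rot p l).
Proof.
move=> pl; have [a [b [-> ->]]] : exists a b, l = a ++ b /\ p = size a.
  by exists (take p l), (drop p l); rewrite cat_take_drop size_takel.
rewrite rot_size_cat; case: e => [|e]; first by [].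
have shift n : wpow n (a ++ b) ++ a = a ++ wpow n (b ++ a).
  by elim: n => [|n IHn]; rewrite ?cats0 // !wpowS -!catA IHn.
by rewrite !wpowS -!catA rot_size_cat -!catA shift.
Qed.

Lemma commuting_power l x e :
  l ++ x = x ++ l -> size x = e * size l -> x = wpow e l.
Proof.
elim: e x => [|e IHe] x lx xs; first by apply/size0nil; rewrite xs.
have slx : size l <= size x by rewrite xs mulSn leq_addr.
have xE : x = l ++ drop (size l) x.
  rewrite -{1}(cat_take_drop (size l) x); congr (_ ++ _).
  by have := congr1 (take (size l)) lx; rewrite take_size_cat // takel_cat.
move: xE; set y := drop _ _ => xE.
rewrite xE wpowS; congr (_ ++ _); apply: IHe; last by rewrite size_drop xs mulSn addKn.
by move/eqP: lx; rewrite xE -!catA eqseq_cat // eqxx => /eqP.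
Qed.

End WordPowers.

Section CountLyndon.
Variable d : nat.
Implicit Types (u v w l m : seq 'I_d).

(** If [l = a ++ b] is smaller than its rotations but not than its suffix [b],
    then [b] is a prefix, [l = b ++ c], and comparing [l] with [b ++ a] gives
    [c < a], whereas comparing [l] with [c ++ b] gives [a <= c]. *)
Lemma lyndon_rotP l : reflect
  (l != [::] /\ forall i, 0 < i < size l -> lex l (rot i l)) (lyndon l).
Proof.
apply: (iffP (lyndonP l)) => -[l0 lP]; split=> //.
  move=> i /andP[i0 il]; rewrite /rot -[X in lex X _]cats0.
  apply: lex_catr; last by rewrite size_drop leq_subr.
  apply: (lP (take i l)); first by rewrite cat_take_drop.
    by rewrite -size_eq0 size_takel -?lt0n // ltnW.
  by rewrite -size_eq0 size_drop -lt0n subn_gt0.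
move=> a b lE a0 b0.
have sa : 0 < size a < size l.
  by rewrite lE size_cat -{2}[size a]addn0 ltn_add2l !lt0n !size_eq0 a0.
have lba : lex l (b ++ a) by have := lP _ sa; rewrite {2}lE rot_size_cat.
rewrite -[lex _ _]negbK lexNle; apply/negP => /orP[/eqP bl|bl].
  by move: (cat_neq b a0); rewrite -lE bl eqxx.
case: (lex_prefix_or bl) => [[c c0 lE']|/(_ a [::])]; last first.
  by rewrite cats0 (lex_asym lba).
have ca : lex c a by move: lba; rewrite lE' lex_cat2l.
have sb : 0 < size b < size l.
  by rewrite lE' size_cat -{2}[size b]addn0 ltn_add2l !lt0n !size_eq0 b0.
have := lP _ sb; rewrite {2}lE' rot_size_cat lE lex_asym // lex_catr //.
by move: (congr1 size lE'); rewrite {1}lE !size_cat addnC => /addnI ->.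
Qed.

Lemma exists_min (s : seq (seq 'I_d)) : s != [::] ->
  exists2 m, m \in s & forall x, x \in s -> lexle m x.
Proof.
elim: s => // a s IHs _; have [->|/IHs[m ms mP]] := eqVneq s [::].
  by exists a; rewrite ?mem_head // => x; rewrite inE => /eqP->; exact: lexle_refl.
have [am|ma] := boolP (lex a m).
  exists a; first exact: mem_head.
  move=> x; rewrite inE => /predU1P[->|/mP mx]; first exact: lexle_refl.
  by apply/orP; right; exact: lex_le_trans mx.
exists m; first by rewrite inE ms orbT.
by move=> x; rewrite inE => /predU1P[->|/mP //]; rewrite -lexNle.
Qed.

Lemma rot_rot_ex p q w : p <= size w -> q <= size w ->
  exists2 r, r <= size w & rot p (rot q w) = rot r w.
Proof.
move=> pw qw; rewrite rot_add_mod //.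
by exists (if p + q <= size w then p + q else p + q - size w) => //; case: ifP; lia.
Qed.

Lemma lyndon_rot_inj l l' p p' : lyndon l -> lyndon l' -> size l = size l' ->
  p <= p' < size l' -> rot p l = rot p' l' -> l = l' /\ p = p'.
Proof.
move=> /lyndon_rotP[_ lP] /lyndon_rotP[_ lP'] sl /andP[pp' p'l].
rewrite -{1}(subnKC pp') rotD ?subnKC //; last exact: ltnW.
move=> /rot_inj lE; case: (posnP (p' - p)) => [pp0|q0].
  by rewrite lE pp0 rot0; split=> //; lia.
set q := p' - p in lE q0; have ql : q < size l'.
  by rewrite /q; apply: leq_ltn_trans p'l; rewrite leq_subr.
have l'l : lex l' l by rewrite [X in lex _ X]lE; apply: lP'; rewrite q0.
have l'E : l' = rot (size l' - q) l.
  by rewrite lE -rotD subnK ?rot_size // ltnW.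
have : lex l l'.
  rewrite [X in lex _ X]l'E; apply: lP; rewrite sl subn_gt0 ql /=.
  by rewrite -subn_gt0 subKn // ltnW.
by rewrite (lex_asym l'l).
Qed.

(** If [l] were shorter than [l'], rotating the common word by [size l] would fix
    it, and hence also its first block [rot p' l']; but the rotations of a Lyndon
    word are distinct. So both blocks have the same length and agree. *)
Lemma wpow_rot_lyndon_inj k l l' p p' : 0 < k -> lyndon l -> lyndon l' ->
  size l %| k -> size l' %| k -> p < size l -> p' < size l' ->
  wpow (k %/ size l) (rot p l) = wpow (k %/ size l') (rot p' l') ->
  l = l' /\ p = p'.
Proof.
move=> k0.
have take1 j u e : 0 < e -> size u = j -> take j (wpow e u) = u.
  by case: e => // e _ <-; rewrite wpowS take_size_cat.
have prim i q u : lyndon u -> 0 < i < size u -> rot i (rot q u) != rot q u.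
  move=> /lyndon_rotP[_ uP] /uP ui; rewrite rot_rot; apply: contraTneq ui.
  by move=> /rot_inj ->; rewrite lex_irr.
have e0 u : lyndon u -> size u %| k -> 0 < k %/ size u.
  move=> lu uk; rewrite divn_gt0; first exact: dvdn_leq.
  by rewrite lt0n size_eq0 lyndon_nil.
have key u u' q q' : lyndon u -> lyndon u' -> size u %| k -> size u' %| k ->
    wpow (k %/ size u) (rot q u) = wpow (k %/ size u') (rot q' u') ->
    ~~ (size u < size u').
  move=> lu lu' uk u'k uu'; apply/negP => lt.
  have u0 : 0 < size u by rewrite lt0n size_eq0 lyndon_nil.
  have : rot (size u) (wpow (k %/ size u) (rot q u)) = wpow (k %/ size u) (rot q u).
    by rewrite rot_wpow ?size_rot // rot_rot rot_size.
  rewrite uu' rot_wpow ?size_rot ?(ltnW lt) // => /(congr1 (take (size u'))).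
  rewrite !take1 ?size_rot ?e0 // => /eqP.
  by rewrite (negPf (prim _ _ _ lu' _)) // u0.
move=> ll ll' lk l'k pl p'l' E.
have sl : size l = size l'.
  apply/eqP; rewrite eqn_leq leqNgt (key l' l p' p) //=.
  by rewrite leqNgt (key l l' p p').
have {}E : rot p l = rot p' l'.
  have := congr1 (take (size l)) E.
  by rewrite !take1 ?size_rot ?e0.
have [pp'|/ltnW p'p] := leqP p p'.
  by apply: lyndon_rot_inj => //; rewrite pp'.
by have [] := @lyndon_rot_inj l' l p' p ll' ll (esym sl) _ (esym E); rewrite ?p'p.
Qed.

(** The smallest rotation of [w] is the power of its initial segment of length
    the least period [j], and minimality makes that segment a Lyndon word. *)
Lemma wpow_rot_lyndon_onto w : w != [::] -> exists l p,
  [/\ lyndon l, size l %| size w, p < size l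
    & w = wpow (size w %/ size l) (rot p l)].
Proof.
move=> w0; have k0 : 0 < size w by rewrite lt0n size_eq0.
set k := size w in k0 *.
have [m] : exists2 m, m \in [seq rot i w | i <- iota 0 k] &
    forall x, x \in [seq rot i w | i <- iota 0 k] -> lexle m x.
  by apply: exists_min; rewrite -size_eq0 size_map size_iota -lt0n.
move=> /mapP[i]; rewrite mem_iota add0n => /andP[_ ik] mE mP.
have sm : size m = k by rewrite mE size_rot.
have mrot r : r <= k -> lexle m (rot r m).
  move=> rk; rewrite {2}mE; have [q qk ->] := rot_rot_ex rk (ltnW ik).
  apply: mP; apply/mapP; have [qk'|kq] := ltnP q k; first by exists q; rewrite ?mem_iota.
  exists 0; rewrite ?mem_iota //; have -> : q = k by lia.
  by rewrite rot0 rot_size.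
have [j /andP[j0 /andP[jk /eqP mj]] jP] := @ex_minnP
  (fun j => (0 < j) && ((j <= k) && (rot j m == m)))
  (ex_intro _ k (introT andP (conj k0 (introT andP (conj (leqnn k)
    (introT eqP (etrans (congr1 (rot^~ m) (esym sm)) (rot_size m)))))))).
have mult a : a * j <= k -> rot (a * j) m = m.
  elim: a => [|a IHa] ajk; first by rewrite mul0n rot0.
  by rewrite mulSn rotD ?IHa //; move: ajk; rewrite mulSn ?sm; lia.
have rmod q : q <= k -> rot q m = rot (q %% j) m.
  move=> qk; rewrite {1}(divn_eq q j) addnC rotD.
    by rewrite mult //; apply: leq_trans qk; exact: leq_trunc_div.
  by rewrite addnC -divn_eq sm.
have jdvd : j %| k.
  case: (posnP (k %% j)) => [/eqP//|r0]; have rj := ltn_pmod k j0.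
  suff : j <= k %% j by rewrite leqNgt rj.
  have rk : rot k m = m by rewrite -sm rot_size.
  by apply: jP; rewrite r0 /= -rmod // rk eqxx andbT leq_mod.
pose l := take j m.
have sl : size l = j by rewrite size_takel // sm.
have mpow : m = wpow (k %/ j) l.
  apply: commuting_power; last by rewrite sl sm divnK.
  have mj' : drop j m ++ l = m := mj.
  by rewrite -{1}mj' catA cat_take_drop.
have e0 : 0 < k %/ j by rewrite divn_gt0 // dvdn_leq.
have ll : lyndon l.
  apply/lyndon_rotP; rewrite -size_eq0 sl -lt0n j0; split=> // r /andP[r0 rj].
  have rk : r <= k by apply: leq_trans (ltnW rj) jk.
  have := mrot r rk; rewrite {1}mpow.
  have -> : rot r m = wpow (k %/ j) (rot r l) by rewrite mpow rot_wpow // sl ltnW.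
  rewrite -(prednK e0) /= lexle_cat2 ?size_rot // => /orP[//|/andP[/eqP lr _]].
  suff : j <= r by rewrite leqNgt rj.
  by apply: jP; rewrite r0 rk /= {1}mpow rot_wpow -?lr -?mpow // sl ltnW.
have wE : w = rot (k - i) m.
  by rewrite mE -[LHS](rotK i) /rotr size_rot.
exists l, ((k - i) %% j); rewrite sl; split=> //; first exact: ltn_pmod.
rewrite wE rmod ?leq_subr // {1}mpow rot_wpow // sl ltnW //; exact: ltn_pmod.
Qed.

Definition words (k : nat) : seq (seq 'I_d) :=
  [seq tval t | t <- enum {: k.-tuple 'I_d}].

Lemma mem_words k w : (w \in words k) = (size w == k).
Proof.
apply/mapP/eqP => [[t _ ->]|wk]; first exact: size_tuple.
have wk' : size w == k by apply/eqP.
by exists (Tuple wk'); rewrite ?mem_enum.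
Qed.

Lemma words_uniq k : uniq (words k).
Proof. by rewrite map_inj_uniq ?enum_uniq //; exact: val_inj. Qed.

Lemma size_words k : size (words k) = d ^ k.
Proof. by rewrite size_map -cardE card_tuple card_ord. Qed.

Definition lyndon_words (k : nat) := [seq w <- words k | lyndon w].

Lemma mem_lyndon_words k w : (w \in lyndon_words k) = lyndon w && (size w == k).
Proof. by rewrite mem_filter mem_words. Qed.

Lemma lyndon_words_uniq k : uniq (lyndon_words k).
Proof. exact/filter_uniq/words_uniq. Qed.

(** Every word of length [k] is in a unique way a power of a rotation of a Lyndon
    word, and a Lyndon word of length [j] has [j] rotations. *)
Lemma sum_lyndon_words k : 0 < k ->
  \sum_(j <- divisors k) j * size (lyndon_words j) = d ^ k.
Proof.
move=> k0; pose s := flatten [seq lyndon_words j | j <- divisors k].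
pose L := [seq wpow (k %/ size l) (rot p l) | l <- s, p <- iota 0 (size l)].
have mem_s l : (l \in s) = lyndon l && (size l %| k).
  apply/flatten_mapP/andP => [[j]|[ll lk]].
    by rewrite -dvdn_divisors // mem_lyndon_words => jk /andP[ll /eqP->].
  by exists (size l); rewrite -?dvdn_divisors // mem_lyndon_words ll eqxx.
have uniq_s : uniq s.
  rewrite /s; elim: (divisors k) (divisors_uniq k) => //= j js IHj /andP[jjs ujs].
  rewrite cat_uniq lyndon_words_uniq IHj // andbT /=; apply/hasPn => l.
  move=> /flatten_mapP[i ijs]; rewrite !mem_lyndon_words => /andP[_ /eqP->].
  by rewrite negb_and; apply/orP; right; apply: contraNneq jjs => <-.
have sizeL : size L = \sum_(j <- divisors k) j * size (lyndon_words j).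
  rewrite size_allpairs_dep sumnE big_map /s big_flatten big_map.
  apply: eq_bigr => j _; rewrite big_seq (eq_bigr (fun=> j)).
    by rewrite -big_seq big_const_seq count_predT iter_addn_0.
  by move=> l; rewrite mem_lyndon_words size_iota => /andP[_ /eqP].
rewrite -sizeL -size_words; apply/perm_size/uniq_perm.
- apply: allpairs_uniq_dep => //; first by move=> l _; exact: iota_uniq.
  move=> _ _ /allpairsPdep[l [p [ls pl ->]]] /allpairsPdep[l' [p' [l's p'l' ->]]] /= E.
  move: ls l's pl p'l'; rewrite !mem_s !mem_iota !add0n.
  move=> /andP[ll lk] /andP[ll' l'k] /= pl p'l'.
  by have [-> ->] := wpow_rot_lyndon_inj k0 ll ll' lk l'k pl p'l' E.
- exact: words_uniq.
- move=> w; rewrite mem_words; apply/allpairsPdep/eqP.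
    move=> [l [p [+ _ ->]]]; rewrite mem_s => /andP[_ lk].
    by rewrite size_wpow size_rot divnK.
  move=> wk; have w0 : w != [::] by rewrite -size_eq0 wk -lt0n.
  have [l [p [ll lw pl wE]]] := wpow_rot_lyndon_onto w0.
  by exists l, p; rewrite mem_s ll -wk lw mem_iota pl.
Qed.

End CountLyndon.

(** * Moebius inversion and the Witt formula *)

Section Moebius.
Import GRing.Theory Num.Theory.
Local Open Scope ring_scope.

Lemma moebius_primeM p j : prime p -> (0 < j)%N -> ~~ (p %| j)%N ->
  moebius (p * j) = - moebius j.
Proof.
move=> pp j0 pj; have p0 := prime_gt0 pp.
have pl : perm_eq (primes (p * j)) (p :: primes j).
  apply: uniq_perm; rewrite ?primes_uniq //=.
    by rewrite primes_uniq andbT mem_primes pp j0 (negPf pj).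
  by move=> q; rewrite primesM // primes_prime // !inE.
have lpj : logn p (p * j) = 1%N.
  by rewrite lognM // logn_prime // eqxx lognE (negPf pj) !andbF.
rewrite /moebius (perm_size pl) (perm_all _ pl) /= lpj eqxx /=.
have -> : all (fun q => logn q (p * j) == 1%N) (primes j) =
          all (fun q => logn q j == 1%N) (primes j).
  apply: eq_in_all => q; rewrite mem_primes => /and3P[pq _ qj].
  rewrite lognM // logn_prime //; case: (eqVneq q p) => // qp.
  by rewrite -qp qj in pj.
by case: ifP => _; rewrite ?oppr0 // exprS mulN1r.
Qed.

Lemma moebius_square p j : prime p -> (0 < j)%N -> (p ^ 2 %| j)%N ->
  moebius j = 0.
Proof.
move=> pp j0; rewrite pfactor_dvdn // => l2.
rewrite /moebius; case: allP => // /(_ p).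
rewrite mem_primes pp j0 -{1}(expn1 p) pfactor_dvdn // (ltnW l2) => /(_ isT).
by move=> /eqP l1; rewrite l1 in l2.
Qed.

(** For a prime divisor [p] of [n], the divisors [j] and [p * j] with [j] prime to
    [p] cancel, and the multiples of [p ^ 2] contribute nothing. *)
Lemma sum_moebius n : (0 < n)%N ->
  \sum_(j <- divisors n) moebius j = (n == 1%N)%:R.
Proof.
move=> n0; have [->|n1] := eqVneq n 1%N; first by rewrite big_seq1.
have n_gt1 : (1 < n)%N by lia.
pose p := pdiv n; have pp : prime p := pdiv_prime n_gt1.
have pn : (p %| n)%N := pdiv_dvd n.
have jn0 j : j \in divisors n -> (0 < j)%N.
  by rewrite -dvdn_divisors // => /dvdn_gt0; apply.
rewrite (bigID (fun j => p %| j)%N) /=.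
have -> : \sum_(j <- divisors n | (p %| j)%N) moebius j =
    \sum_(j <- [seq j <- divisors n | (p %| j)%N && ~~ (p ^ 2 %| j)%N]) moebius j.
  rewrite big_filter big_seq_cond [RHS]big_seq_cond.
  rewrite (bigID (fun j => p ^ 2 %| j)%N) /= big1 ?add0r.
    by apply: eq_bigl => j; rewrite -!andbA.
  by move=> j /andP[/andP[/jn0 j0 _] pj]; exact: moebius_square pp j0 pj.
have pl : perm_eq [seq j <- divisors n | (p %| j)%N && ~~ (p ^ 2 %| j)%N]
    [seq (p * j)%N | j <- [seq j <- divisors n | ~~ (p %| j)%N]].
  apply: uniq_perm; first exact/filter_uniq/divisors_uniq.
    rewrite map_inj_uniq; first exact/filter_uniq/divisors_uniq.
    by move=> x y /eqP; rewrite eqn_pmul2l ?prime_gt0 // => /eqP.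
  move=> x; rewrite mem_filter -dvdn_divisors //; apply/idP/mapP.
    move=> /andP[/andP[/dvdnP[j ->] p2]] jn; exists j; last exact: mulnC.
    rewrite mem_filter -dvdn_divisors // (dvdn_trans (dvdn_mulr p (dvdnn j)) jn) andbT.
    by apply: contra p2 => pj; rewrite expnS expn1 dvdn_mul.
  move=> [j]; rewrite mem_filter -dvdn_divisors // => /andP[pj jn] ->.
  rewrite dvdn_mulr //= expnS expn1 dvdn_pmul2l ?prime_gt0 // pj /=.
  by rewrite Gauss_dvd ?pn // prime_coprime.
rewrite (perm_big _ pl) big_map -[X in _ + X]big_filter.
rewrite addrC big_seq [X in _ + X]big_seq.
rewrite -[X in _ + X]opprK -sumrN; apply/eqP; rewrite subr_eq0; apply/eqP.
apply: eq_bigr => j; rewrite mem_filter => /andP[pj /jn0 j0].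
by rewrite moebius_primeM ?opprK.
Qed.

Lemma chi_lyndon k d : (0 < k)%N ->
  chi k d%:R = (size (lyndon_words d k))%:R.
Proof.
move=> k0; rewrite /chi; pose f i := (i * size (lyndon_words d i))%N.
pose D := divisors k.
have DP i : (i \in D) = (i %| k)%N by rewrite -dvdn_divisors.
have sub (g : nat -> rat) i : i \in D -> \sum_(j <- divisors (k %/ i)) g j =
    \sum_(j <- D | (j * i %| k)%N) g j.
  rewrite DP => ik; have i0 := dvdn_gt0 k0 ik.
  rewrite -[RHS]big_filter; apply/perm_big/uniq_perm.
  - exact: divisors_uniq.
  - exact/filter_uniq/divisors_uniq.
  have ki0 : (0 < k %/ i)%N by rewrite divn_gt0 // dvdn_leq.
  move=> j; rewrite mem_filter DP -dvdn_divisors // dvdn_divRL //.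
  by case ji: (j * i %| k)%N => //=; rewrite (dvdn_trans (dvdn_mulr i (dvdnn j)) ji).
have -> : \sum_(j <- D) (moebius j)%:~R * d%:R ^+ (k %/ j) =
    \sum_(j <- D) \sum_(i <- D | (i * j %| k)%N) (moebius j)%:~R * (f i)%:R :> rat.
  rewrite big_seq [RHS]big_seq; apply: eq_bigr => j jD.
  have jk : (j %| k)%N by rewrite -DP.
  have j0 := dvdn_gt0 k0 jk.
  have kj0 : (0 < k %/ j)%N by rewrite divn_gt0 // dvdn_leq.
  rewrite -mulr_sumr -(sub (fun i => (f i)%:R) j jD); congr (_ * _).
  by rewrite -natrX -(sum_lyndon_words d kj0) natr_sum.
rewrite (exchange_big_dep predT) //=.
have -> : \sum_(i <- D) \sum_(j <- D | (i * j %| k)%N) (moebius j)%:~R * (f i)%:R =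
    \sum_(i <- D) (f i)%:R * (i == k)%:R :> rat.
  rewrite big_seq [RHS]big_seq; apply: eq_bigr => i iD.
  have i0 : (0 < i)%N by rewrite (dvdn_gt0 k0) // -DP.
  have ik : (i %| k)%N by rewrite -DP.
  rewrite -mulr_suml mulrC; congr (_ * _).
  under eq_bigl => j do rewrite mulnC.
  have ki0 : (0 < k %/ i)%N by rewrite divn_gt0 // dvdn_leq.
  rewrite -sub // -rmorph_sum /= sum_moebius //.
  have -> : (k %/ i == 1)%N = (i == k).
    by rewrite -(eqn_pmul2r i0) divnK // mul1n eq_sym.
  by case: (i == k).
rewrite (bigD1_seq k) ?divisors_uniq ?DP //= eqxx mulr1 big1 ?addr0.
  by rewrite /f natrM mulKf // pnatr_eq0 -lt0n.
by move=> i /negPf->; rewrite mulr0.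
Qed.

End Moebius.

(** * The Magnus embedding *)

Section Series.
Import GRing.Theory.
Local Open Scope ring_scope.
Variable d : nat.
Notation word := (seq 'I_d).

Definition ncseries := word -> int.
Implicit Types (f g h : ncseries) (w : word).

(** The Cauchy product ([convE]), by recursion through the left derivations
    [f |-> (fun u => f (a :: u))], for which associativity is a direct
    induction. *)
Fixpoint conv f g w : int :=
  if w is a :: w' then f [::] * g w + conv (fun u => f (a :: u)) g w'
  else f [::] * g [::].

Definition ncone : ncseries := fun w => (w == [::])%:R.

Lemma convE f g w :
  conv f g w = \sum_(0 <= i < (size w).+1) f (take i w) * g (drop i w).
Proof.
elim: w f => [|a w IHw] f; first by rewrite big_nat1.
by rewrite big_nat_recl //= IHw.
Qed.

Lemma convD f f' g w :
  conv (fun u => f u + f' u) g w = conv f g w + conv f' g w.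
Proof. by elim: w f f' => [|a w IHw] f f' /=; rewrite ?IHw; ring. Qed.

Lemma convZ (c : int) f g w : conv (fun u => c * f u) g w = c * conv f g w.
Proof. by elim: w f => [|a w IHw] f /=; rewrite ?IHw; ring. Qed.

Lemma convA f g h : conv f (conv g h) = conv (conv f g) h.
Proof.
apply/funext => w; elim: w f g => [|a w IHw] f g /=; first by rewrite mulrA.
by rewrite IHw convD convZ; ring.
Qed.

Lemma conv0 g w : conv (fun=> 0) g w = 0.
Proof. by elim: w => [|a w IHw] /=; rewrite ?IHw mul0r. Qed.

Lemma conv1 g : conv ncone g = g.
Proof.
apply/funext => -[|a w] /=; first by rewrite mul1r.
by rewrite mul1r conv0 addr0.
Qed.

Lemma convr1 f : conv f ncone = f.
Proof.
apply/funext => w; elim: w f => [|a w IHw] f /=; first by rewrite mulr1.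
by rewrite IHw mulr0 add0r.
Qed.

(** Carrying the inverse along makes this a group without any construction of
    inverse series. *)
Record munit := MUnit {
  mval :> word -> int;
  minv : ncseries;
  mval0 : mval [::] = 1;
  mvalK : conv mval minv = ncone;
  minvK : conv minv mval = ncone }.

Lemma munit_inj (u v : munit) : mval u = mval v -> u = v.
Proof.
case: u v => [f f' f0 ff' f'f] [g g' g0 gg' g'g] /= fg.
have fg' : f' = g' by rewrite -[f']convr1 -gg' convA -fg f'f conv1.
case: _ / fg in g0 gg' g'g *; case: _ / fg' in gg' g'g *.
by congr MUnit; exact: Prop_irrelevance.
Qed.

HB.instance Definition _ := gen_eqMixin munit.
HB.instance Definition _ := gen_choiceMixin munit.

Definition munit_one : munit := MUnit (erefl : ncone [::] = 1) (conv1 _) (conv1 _).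

Fact munit_mul0 (u v : munit) : conv u v [::] = 1.
Proof. by rewrite /= !mval0 mulr1. Qed.

Fact munit_mulK (u v : munit) : conv (conv u v) (conv (minv v) (minv u)) = ncone.
Proof. by rewrite convA -(convA u) mvalK convr1 mvalK. Qed.

Fact munit_mulVK (u v : munit) : conv (conv (minv v) (minv u)) (conv u v) = ncone.
Proof. by rewrite convA -(convA (minv v)) minvK convr1 minvK. Qed.

Definition munit_mul (u v : munit) : munit :=
  MUnit (munit_mul0 u v) (munit_mulK u v) (munit_mulVK u v).

Fact minv0 (u : munit) : minv u [::] = 1.
Proof. by have := congr1 (@^~ [::]) (mvalK u); rewrite /= mval0 mul1r. Qed.

Definition munit_inv (u : munit) : munit := MUnit (minv0 u) (minvK u) (mvalK u).

Fact munit_mulA : associative munit_mul.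
Proof. by move=> u v w; apply: munit_inj; exact: convA. Qed.
Fact munit_mul1 : left_id munit_one munit_mul.
Proof. by move=> u; apply: munit_inj; exact: conv1. Qed.
Fact munit_mulr1 : right_id munit_one munit_mul.
Proof. by move=> u; apply: munit_inj; exact: convr1. Qed.
Fact munit_mulV : left_inverse munit_one munit_inv munit_mul.
Proof. by move=> u; apply: munit_inj; exact: minvK. Qed.
Fact munit_mulrV : right_inverse munit_one munit_inv munit_mul.
Proof. by move=> u; apply: munit_inj; exact: mvalK. Qed.

HB.instance Definition _ := isGroup.Build munit munit_mulA munit_mul1
  munit_mulr1 munit_mulV munit_mulrV.

(** The unit [1 + X_a] and its inverse, the alternating sum of the powers of
    [X_a]. *)
Definition mgen_val (a : 'I_d) : ncseries :=
  fun w => (w == [::])%:R + (w == [:: a])%:R.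

Definition mgen_inv (a : 'I_d) : ncseries :=
  fun w => if all (pred1 a) w then (-1) ^+ size w else 0.

Lemma mgen_valS a b w : mgen_val a (b :: w) = (b == a)%:R * ncone w.
Proof.
by rewrite /mgen_val /ncone eqseq_cons add0r; case: (b == a); rewrite ?mul1r ?mul0r.
Qed.

Lemma mgen_invS a b w : mgen_inv a (b :: w) = - (b == a)%:R * mgen_inv a w.
Proof.
rewrite /mgen_inv [all _ (_ :: _)]/= [size _]/=; case: (b == a); last first.
  by rewrite oppr0 mul0r.
by rewrite andTb; case: ifP => _; [rewrite exprS | rewrite mulr0].
Qed.

Fact mgenK a : conv (mgen_val a) (mgen_inv a) = ncone.
Proof.
apply/funext => -[|b w]; first by [].
have -> : conv (mgen_val a) (mgen_inv a) (b :: w) = mgen_val a [::] *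
  mgen_inv a (b :: w) + conv (fun u => mgen_val a (b :: u)) (mgen_inv a) w by [].
have -> : (fun u => mgen_val a (b :: u)) = (fun u => (b == a)%:R * ncone u).
  by apply/funext => u; rewrite mgen_valS.
have -> : mgen_val a [::] = 1 by [].
have -> : ncone (b :: w) = 0 by [].
by rewrite convZ conv1 mgen_invS; ring.
Qed.

Fact mgenVK a : conv (mgen_inv a) (mgen_val a) = ncone.
Proof.
apply/funext; elim=> [|b w IHw]; first by [].
have -> : conv (mgen_inv a) (mgen_val a) (b :: w) = mgen_inv a [::] *
  mgen_val a (b :: w) + conv (fun u => mgen_inv a (b :: u)) (mgen_val a) w by [].
have -> : (fun u => mgen_inv a (b :: u)) = (fun u => - (b == a)%:R * mgen_inv a u).
  by apply/funext => u; rewrite mgen_invS.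
have -> : mgen_inv a [::] = 1 by [].
have -> : ncone (b :: w) = 0 by [].
by rewrite convZ IHw mgen_valS; ring.
Qed.

Definition mgen a : munit :=
  @MUnit (mgen_val a) (mgen_inv a) erefl (mgenK a) (mgenVK a).

(** The filtration of the units by the order of [u - 1]. *)
Definition munit_deg (k : nat) (u : munit) :=
  forall w, (0 < size w < k)%N -> u w = 0.

Lemma munit_deg1 u : munit_deg 1 u.
Proof. by move=> w; lia. Qed.

(** Up to length [k + l], only the splitting of a word after [k] letters
    contributes to a product, besides the two trivial ones. *)
Lemma conv_low k l (u v : munit) w : (0 < k)%N -> (0 < l)%N ->
  munit_deg k u -> munit_deg l v -> (0 < size w <= k + l)%N ->
  conv u v w = u w + v w +
    if size w == (k + l)%N then u (take k w) * v (drop k w) else 0.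
Proof.
move=> k0 l0 uk vl /andP[w0 wkl]; rewrite convE.
rewrite big_nat_recl // take0 drop0 mval0 mul1r.
rewrite -(prednK w0) big_nat_recr //= prednK // take_size drop_size mval0 mulr1.
set S := \sum_(0 <= i < _) _.
have -> : S = if size w == (k + l)%N then u (take k w) * v (drop k w) else 0.
  rewrite /S; case: eqP => wkl'.
    rewrite (big_cat_nat (n := k.-1)) //=; last by lia.
    rewrite big_nat_cond big1 ?add0r => [|i]; last first.
      rewrite andbT => /andP[_ ik]; rewrite uk ?mul0r // size_takel; lia.
    rewrite big_ltn; last by lia.
    rewrite big_nat_cond big1 ?addr0 ?prednK // => i.
    rewrite andbT => /andP[ik iw]; rewrite vl ?mulr0 // size_drop; lia.
  rewrite big_nat_cond big1 // => i; rewrite andbT => /andP[_ iw].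
  have [ik|ki] := ltnP i.+1 k.
    by rewrite uk ?mul0r // size_takel; lia.
  by rewrite vl ?mulr0 // size_drop; lia.
by ring.
Qed.

Local Open Scope group_scope.

Lemma munit_degM k (u v : munit) w : (0 < k)%N -> munit_deg k u -> munit_deg k v ->
  (0 < size w <= k)%N -> (u * v) w = (u w + v w)%R.
Proof.
move=> k0 uk vk wk; rewrite [LHS](@conv_low k k u v) //; last by lia.
by case: eqP => [|_]; [lia | rewrite addr0].
Qed.

Lemma munit_degM_closed k (u v : munit) : (0 < k)%N ->
  munit_deg k u -> munit_deg k v -> munit_deg k (u * v).
Proof.
move=> k0 uk vk w wk; rewrite (munit_degM k0 uk vk); last by lia.
by rewrite uk // vk // addr0.
Qed.

Lemma munit_degV k (u : munit) : (0 < k)%N -> munit_deg k u -> munit_deg k u^-1.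
Proof.
move=> k0 uk; suff H n w : (size w < n)%N -> (0 < size w < k)%N -> u^-1 w = 0%R.
  by move=> w; exact: (H (size w).+1).
elim: n w => // n IHn w wn wk.
have uV : munit_deg (size w) u^-1 by move=> x xw; apply: IHn; lia.
have uw : munit_deg (size w) u by move=> x xw; apply: uk; lia.
have w0 : (0 < size w)%N by lia.
have := munit_degM w0 uw uV; move=> /(_ w); rewrite mulgV uk // add0r leqnn w0.
by move=> <- //; case: w {wn wk uV uw} w0.
Qed.

(** Compare the coefficients in [u * v = v * u * [~ u, v]], by induction on the
    length of the words: the lowest terms of the group commutator are those of
    the ring commutator. *)
Lemma munit_deg_comm k l (u v : munit) w : (0 < k)%N -> (0 < l)%N ->
  munit_deg k u -> munit_deg l v -> (0 < size w <= k + l)%N ->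
  [~ u, v] w = (if size w == (k + l)%N then
    u (take k w) * v (drop k w) - v (take l w) * u (drop l w) else 0)%R.
Proof.
move=> k0 l0 uk vl; set z := [~ u, v].
have uvz : u * v = v * u * z by rewrite -commgC.
suff H n : (n <= k + l)%N -> forall w, (0 < size w <= n)%N ->
    z w = (if size w == (k + l)%N then
    u (take k w) * v (drop k w) - v (take l w) * u (drop l w) else 0)%R.
  by move=> wkl; apply: (H (k + l)%N).
elim: n => [|n IHn] nkl {}w wn; first by lia.
have zdeg : munit_deg n.+1 z.
  move=> x xn; rewrite IHn; [|lia..]; case: eqP => //; lia.
have := congr1 (fun t : munit => t w) uvz.
rewrite [X in X = _](conv_low k0 l0 uk vl); last by lia.
have -> : (v * u * z) w = ((v * u)%g w + z w)%R.
  rewrite [LHS](@conv_low 1 n.+1 (v * u) z) //; [|exact: munit_deg1|by lia].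
  by case: eqP => [|_]; [lia | rewrite addr0].
rewrite [X in _ = (X + _)%R](conv_low l0 k0 vl uk); last by lia.
rewrite [(l + k)%N]addnC => E.
move: E; case: eqP => _ E.
  by apply: (addrI (v w + u w + v (take l w) * u (drop l w))%R); rewrite -E; ring.
by apply: (addrI (v w + u w + 0)%R); rewrite -E; ring.
Qed.

End Series.

Section MagnusFiltration.
Local Open Scope classical_set_scope.
Local Open Scope group_scope.
Variables (d : nat) (G : groupType) (mu : {multiplicative G -> munit d}).

Lemma munit_deg_lcs n : lcs setT setT n `<=` [set g | munit_deg n.+1 (mu g)].
Proof.
elim: n => [|n IHn]; first by move=> g _; exact: munit_deg1.
rewrite lcsS; apply: comm_subgroup_sub.
  split=> [|x y /= xn yn]; first by rewrite /= gmorph1 => -[|a w].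
  by rewrite gmulfM gmorphV; apply: munit_degM_closed => //; exact: munit_degV.
move=> x y /IHn /= xn _ w wn.
have -> : mu [~ x, y] = [~ mu x, mu y].
  by rewrite (@mult_onR _ _ setT) //; exact: mult_onW.
rewrite (@munit_deg_comm _ n.+1 1) //; [|exact: munit_deg1|by lia].
by case: eqP => //; lia.
Qed.

End MagnusFiltration.

(** * Lyndon commutators form bases of the lower central sections *)

Section LowerCentral.
Local Open Scope classical_set_scope.
Local Open Scope group_scope.
Variable G : groupType.
Implicit Types (x y a b c g : G) (N : set G).
Notation gam n := (@lower_central G n).

Lemma gam_comm i j : 0 < i -> 0 < j ->
  comm_subgroup (gam i) (gam j) `<=` gam (i + j).
Proof.
move=> i0 j0; have nT := normal_setT G.
have -> : i + j = (i.-1 + j.-1).+2 by lia.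
exact: (@lcs_comm _ setT setT i.-1 j.-1).
Qed.

Lemma gam_mem_comm i j x y : 0 < i -> 0 < j -> gam i x -> gam j y ->
  gam (i + j) [~ x, y].
Proof. by move=> i0 j0 xi yj; apply: gam_comm => //; exact: mem_comm_subgroup. Qed.

Lemma gam_le i j : i <= j -> gam j `<=` gam i.
Proof.
move=> ij; apply: (@lcsW _ setT setT i.-1 j.-1); [exact: normal_setT..|lia].
Qed.

(** The Jacobi identity modulo the next term of the lower central series: there,
    the inverses and conjugations in the Hall-Witt identity have no effect. *)
Lemma gam_jacobi N i j k a b c : is_normal N ->
  0 < i -> 0 < j -> 0 < k -> gam (i + j + k).+1 `<=` N ->
  gam i a -> gam j b -> gam k c ->
  N [~ a, c, b] -> N [~ a, [~ b, c]] -> N [~ a, b, c].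
Proof.
move=> nN i0 j0 k0 sN ai bj ck Nacb Nabc.
have [[_ _] NJ] := nN.
have NV x : N x -> N x^-1 by exact: subgroupV nN.1.
have NC x y : N [~ x, y] -> N [~ y, x] by rewrite -[[~ y, x]]invgR; exact: NV.
have NVl x y : N [~ x, y] -> N [~ x^-1, y].
  move=> /(coset_commute nN) /commute_sym/commuteV/commute_sym; rewrite -gmulfV.
  by move=> /(coset_commute nN).
have NVr x y : N [~ x, y] -> N [~ x, y^-1] by move=> /NC/NVl/NC.
have NJl m n x y g : 0 < m -> 0 < n -> (m + n = i + j + k)%N ->
    gam m x -> gam n y -> N [~ x, y] -> N [~ x ^ g, y].
  move=> m0 n0 mn xm yn Nxy; have -> : x ^ g = x * [~ x, g] by rewrite commgEl mulVKg.
  apply/(coset_commute nN)/commute_sym; rewrite gmulfM; apply: commuteM.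
    exact/commute_sym/(coset_commute nN).
  apply/commute_sym/(coset_commute nN)/sN.
  have -> : (i + j + k).+1 = (m.+1 + n)%N by lia.
  apply: gam_mem_comm => //; rewrite -addn1; exact: gam_mem_comm.
have gbc : gam (j + k) [~ b, c] by exact: gam_mem_comm.
have gca : gam (k + i) [~ c, a] by exact: gam_mem_comm.
have hw := Hall_Witt a b^-1 c; rewrite invgK in hw.
have N2 : N ([~ b^-1, c^-1, a] ^ c).
  apply: NJ; have -> : [~ b^-1, c^-1] = [~ b, c] ^ (b^-1 * c^-1).
    by rewrite /commg /conjg !invgM !invgK !mulgA mulgK mulgV mul1g.
  by apply: (NJl (j + k)%N i) => //; [lia..|exact: NC].
have N3 : N ([~ c, a^-1, b^-1] ^ a).
  apply: NJ; apply: NVr; have -> : [~ c, a^-1] = ([~ c, a] ^ a^-1)^-1.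
    by rewrite /commg /conjg !invgM !invgK !mulgA mulgV mul1g.
  apply: (NVl); apply: (NJl (k + i)%N j) => //; [lia..|].
  by rewrite -[[~ c, a]]invgR; exact: (NVl).
have N1 : N ([~ a, b, c] ^ b^-1).
  have -> : [~ a, b, c] ^ b^-1 = ([~ b^-1, c^-1, a] ^ c * [~ c, a^-1, b^-1] ^ a)^-1.
    apply: (mulIg ([~ b^-1, c^-1, a] ^ c * [~ c, a^-1, b^-1] ^ a)).
    by rewrite mulVg mulgA.
  by apply: NV; apply: subgroupM nN.1 N2 N3.
by rewrite -[[~ a, b, c]]conjg1 -(mulVg b) conjgM; exact: NJ.
Qed.

End LowerCentral.

Section Spanning.
Local Open Scope classical_set_scope.
Local Open Scope group_scope.
Variables (d : nat) (G : groupType) (x : 'I_d -> G).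
Hypothesis x_gen : generated (range x) = setT.
Notation gam n := (@lower_central G n).
Implicit Types (u v w : seq 'I_d).

Local Notation below v := (fun w : seq 'I_d => lex w v).

Fixpoint lyndon_comm_rec (n : nat) w : G :=
  if n is n'.+1 then
    match w with
    | [::] => 1
    | [:: a] => x a
    | _ => [~ lyndon_comm_rec n' (std w).1, lyndon_comm_rec n' (std w).2]
    end
  else 1.

(** The length of [w] is enough fuel, as both factors of the standard
    factorization are shorter. *)
Definition lyndon_comm w := lyndon_comm_rec (size w) w.

Lemma size_std w : 1 < size w ->
  [/\ 0 < size (std w).1, 0 < size (std w).2
    & size (std w).1 + size (std w).2 = size w].
Proof.
move=> w1; move: (stdP w1); case: (std w) => u v [/= -> u0 v0 _].
by rewrite !lt0n !size_eq0 u0 v0 size_cat.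
Qed.

Lemma size_std_lt w : 1 < size w ->
  size (std w).1 < size w /\ size (std w).2 < size w.
Proof.
by move=> w1; have [s1 s2 <-] := size_std w1; lia.
Qed.

Lemma lyndon_comm_recE n m w : size w <= n -> size w <= m ->
  lyndon_comm_rec n w = lyndon_comm_rec m w.
Proof.
elim: n m w => [|n IHn] [|m] [|a [|b w]] // wn wm.
have [l1 l2] := @size_std_lt [:: a, b & w] isT.
rewrite [LHS]/= [RHS]/=; congr [~ _, _]; apply: IHn; rewrite -ltnS.
- exact: leq_trans l1 wn.
- exact: leq_trans l1 wm.
- exact: leq_trans l2 wn.
- exact: leq_trans l2 wm.
Qed.

Lemma lyndon_comm1 a : lyndon_comm [:: a] = x a.
Proof. by []. Qed.

Lemma lyndon_commE w : 1 < size w ->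
  lyndon_comm w = [~ lyndon_comm (std w).1, lyndon_comm (std w).2].
Proof.
move=> w1; have [s1 s2 s12] := size_std w1; rewrite /lyndon_comm.
have -> : lyndon_comm_rec (size w) w =
  [~ lyndon_comm_rec (size w).-1 (std w).1, lyndon_comm_rec (size w).-1 (std w).2].
  by case: w w1 {s1 s2 s12} => [|a [|b w]].
by congr [~ _, _]; apply: lyndon_comm_recE; lia.
Qed.

Lemma lyndon_comm_gam w : w != [::] -> gam (size w) (lyndon_comm w).
Proof.
have [n] := ubnP (size w); elim: n w => // n IHn w wn w0.
have [w1|w1] := ltnP 1 (size w); last first.
  by case: w w0 w1 {wn} => [|a [|b w]].
have [s1 s2 s12] := size_std w1; rewrite lyndon_commE // -s12.
by apply: gam_mem_comm => //; apply: IHn; rewrite ?s1 ?s2 -?size_eq0 -?lt0n //; lia.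
Qed.

(** Containing [gamma_(n+1)] makes it normal, so that memberships can be checked
    modulo it. *)
Definition lyndon_span (n : nat) (P : pred (seq 'I_d)) : set G :=
  generated ([set z | exists w, [/\ lyndon w, size w = n, P w & z = lyndon_comm w]]
             `|` gam n.+1).

Lemma gam_lyndon_span n P : gam n.+1 `<=` lyndon_span n P.
Proof. by move=> z zn; apply: sub_generated; right. Qed.

Lemma mem_lyndon_span n (P : pred (seq 'I_d)) w :
  lyndon w -> size w = n -> P w -> lyndon_span n P (lyndon_comm w).
Proof. by move=> lw wn Pw; apply: sub_generated; left; exists w. Qed.

Lemma lyndon_spanS n (P Q : pred (seq 'I_d)) :
  (forall w, size w = n -> P w -> Q w) -> lyndon_span n P `<=` lyndon_span n Q.
Proof.
move=> PQ; apply: generated_sub (generated_subgroup _) _ => z.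
move=> [[w [lw wn Pw ->]]|zn]; last exact: gam_lyndon_span.
by apply: mem_lyndon_span => //; exact: PQ.
Qed.

Lemma lyndon_span_sub n P : 0 < n -> lyndon_span n P `<=` gam n.
Proof.
move=> n0; apply: generated_sub; first exact: (lower_central_normal G n).1.
move=> z [[w [lw wn _ ->]]|]; last exact: gam_le.
by rewrite -wn; apply: lyndon_comm_gam; exact: lyndon_nil.
Qed.

Lemma lyndon_span_normal n P : 0 < n -> is_normal (lyndon_span n P).
Proof.
move=> n0; have sS : is_subgroup (lyndon_span n P) by exact: generated_subgroup.
split=> // z g Sz.
have -> : z ^ g = z * [~ z, g] by rewrite commgEl mulVKg.
apply: (subgroupM sS Sz); apply: gam_lyndon_span; rewrite -addn1.
by apply: gam_mem_comm => //; exact: lyndon_span_sub Sz.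
Qed.

Fact count_lex_lt (s : seq (seq 'I_d)) v v' : v' \in s -> lex v' v ->
  count (below v') s < count (below v) s.
Proof.
move=> + v'v; have sub w : lex w v' -> lex w v by move/lex_trans; apply.
have le t : count (below v') t <= count (below v) t by exact: sub_count.
elim: s => // w s IHs; rewrite inE /= => /predU1P[<-|/IHs lt].
  by rewrite lex_irr v'v add0n ltnS.
by rewrite -addnS; apply: leq_add lt; case E: (lex w v') => //; rewrite sub.
Qed.

(** The rewriting step of the theory of Lyndon words. If the product [u ++ v]
    has standard factorization [(u, v)], then [[u, v]] is the commutator of
    [u ++ v]; otherwise [u = u1 ++ u2] with [u2 < v], and the Jacobi identity
    replaces [[u, v]] by commutators of shorter words, which are expanded into
    words smaller than [v], and then of pairs with a smaller maximum. *)
Lemma lyndon_span_bracket u v : lyndon u -> lyndon v -> lex u v ->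
  lyndon_span (size u + size v) (below v) [~ lyndon_comm u, lyndon_comm v].
Proof.
have [n] := ubnP (size u + size v); elim: n u v => // n IHn u v.
have [m] := ubnP (count (below v) (flatten [seq words d i | i <- iota 0 n.+1])).
elim: m u v => // m IHm u v vm uvn lu lv uv.
pose N := lyndon_span (size u + size v) (below v).
have u0 := lyndon_nil lu; have v0 := lyndon_nil lv.
have su : 0 < size u by rewrite lt0n size_eq0.
have sv : 0 < size v by rewrite lt0n size_eq0.
have nN : is_normal N by apply: lyndon_span_normal; rewrite addn_gt0 su.
have NC a b : N [~ a, b] -> N [~ b, a].
  by rewrite -[[~ b, a]]invgR; exact: subgroupV nN.1.
have [ltu2v|std_uv] := boolP ((1 < size u) && lex (std u).2 v); last first.
  have uvE : std (u ++ v) = (u, v).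
    apply: std_cat => // u1; move: std_uv; rewrite u1 /= => u2v.
    by rewrite -lexNle.
  have -> : [~ lyndon_comm u, lyndon_comm v] = lyndon_comm (u ++ v).
    by rewrite [RHS]lyndon_commE ?uvE // size_cat; lia.
  apply: mem_lyndon_span; [exact: lyndon_cat|exact: size_cat|exact: lyndon_cat_lt].
have /andP[u1 u2v] := ltu2v.
have [s1 s2 s12] := size_std u1; have := lyndon_std lu u1.
rewrite (lyndon_commE u1); move: (stdP u1) s1 s2 s12 u2v.
case: (std u) => u1' u2 /= [uE u1'0 u20 _] s1 s2 s12 u2v [lu1 lu2 u1u2].
have u1v : lex u1' v.
  by apply: lex_trans uv; rewrite uE; exact: lex_cat.
have pair_below s t : lyndon s -> lyndon t -> size s + size t = size u + size v ->
    lex s v -> lex t v -> N [~ lyndon_comm s, lyndon_comm t].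
  have wlog s' t' : lyndon s' -> lyndon t' -> size s' + size t' = size u + size v ->
      lex s' t' -> lex t' v -> N [~ lyndon_comm s', lyndon_comm t'].
    move=> ls lt st s't' t'v.
    have s'0 : 0 < size s' by rewrite lt0n size_eq0 lyndon_nil.
    have : lyndon_span (size s' + size t') (below t')
        [~ lyndon_comm s', lyndon_comm t'].
      apply: IHm => //; last by rewrite st.
      apply: leq_trans (count_lex_lt _ t'v) _; last by rewrite -ltnS.
      apply/flatten_mapP; exists (size t'); last by rewrite mem_words.
      by rewrite mem_iota add0n; apply: leq_trans uvn; rewrite ltnS -st leq_addl.
    rewrite st; apply: lyndon_spanS => w _ wt'; exact: lex_trans wt' t'v.
  move=> ls lt st sv' tv; case: (eqVneq s t) => [->|/lex_total/orP[st'|ts]].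
  - by rewrite commgg; exact: nN.1.1.
  - exact: wlog.
  - by apply: NC; apply: wlog => //; rewrite addnC.
have span_below k s y : 0 < k -> lyndon_span k (below v) y -> lyndon s -> lex s v ->
    k + size s = size u + size v -> N [~ y, lyndon_comm s].
  move=> k0 yk ls sv' ks.
  suff : comm_subgroup (lyndon_span k (below v)) (generated [set lyndon_comm s]) `<=` N.
    by apply; apply: mem_comm_subgroup => //; apply: sub_generated.
  have s0 : 0 < size s by rewrite lt0n size_eq0 lyndon_nil.
  apply: comm_generated_sub => // z _ [[w [lw wk wv ->]]|zk] ->.
    by apply: pair_below => //; rewrite wk.
  apply: gam_lyndon_span; rewrite -ks -addSn; apply: gam_mem_comm => //.
  by apply: lyndon_comm_gam; exact: lyndon_nil.
have gamL w : lyndon w -> gam (size w) (lyndon_comm w).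
  by move=> lw; apply: lyndon_comm_gam; exact: lyndon_nil.
have sN : gam (size u1' + size u2 + size v).+1 `<=` N.
  by rewrite s12; exact: gam_lyndon_span.
apply: (gam_jacobi nN s1 s2 sv sN (gamL _ lu1) (gamL _ lu2) (gamL _ lv)).
- apply: (span_below (size u1' + size v)) => //.
  + by rewrite addn_gt0 s1.
  + apply: IHn => //; rewrite -ltnS; apply: leq_trans uvn.
    by rewrite ltnS -s12 ltn_add2r -[X in X < _]addn0 ltn_add2l.
  + by rewrite addnAC s12.
- apply: NC; apply: (span_below (size u2 + size v)) => //.
  + by rewrite addn_gt0 s2.
  + apply: IHn => //; rewrite -ltnS; apply: leq_trans uvn.
    by rewrite ltnS -s12 ltn_add2r -[X in X < _]add0n ltn_add2r.
  + by rewrite addnAC [size u2 + _]addnC s12.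
Qed.

Lemma gam_sub_lyndon_span n : 0 < n -> gam n `<=` lyndon_span n predT.
Proof.
have gT : [set: G] `<=` lyndon_span 1 predT.
  rewrite -x_gen; apply: generated_sub (generated_subgroup _) _ => z [a _ <-].
  by apply: sub_generated; left; exists [:: a].
case: n => // n _; elim: n => [|n IHn]; first exact: gT.
have nS := @lyndon_span_normal n.+2 predT isT.
have SC a b : lyndon_span n.+2 predT [~ a, b] -> lyndon_span n.+2 predT [~ b, a].
  by rewrite -[[~ b, a]]invgR; exact: subgroupV nS.1.
have sub : gam n.+2 `<=` comm_subgroup (lyndon_span n.+1 predT) (lyndon_span 1 predT).
  exact: (comm_subgroupS IHn gT).
apply: (subset_trans sub); apply: comm_generated_sub => // y z.
have bracket u v : lyndon u -> lyndon v -> size u + size v = n.+2 -> lex u v ->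
    lyndon_span n.+2 predT [~ lyndon_comm u, lyndon_comm v].
  move=> lu lv uv ltuv; have := lyndon_span_bracket lu lv ltuv.
  by rewrite uv; apply: lyndon_spanS.
move=> [[u [lu un _ ->]]|yn].
  move=> [[v [lv vn _ ->]]|zn].
    have [<-|/lex_total/orP[uv|vu]] := eqVneq u v.
    - by rewrite commgg; exact: nS.1.1.
    - by apply: bracket => //; lia.
    - by apply: SC; apply: bracket => //; lia.
  apply: gam_lyndon_span; rewrite -addn2; apply: gam_mem_comm => //.
  by rewrite -un; apply: lyndon_comm_gam; exact: lyndon_nil.
move=> _; apply: gam_lyndon_span; rewrite -[n.+3]addn1; exact: gam_mem_comm.
Qed.

End Spanning.

Section Independence.
Import GRing.Theory.
Local Open Scope classical_set_scope.
Local Open Scope group_scope.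
Variables (d : nat) (G : groupType) (x : 'I_d -> G).
Variable mu : {multiplicative G -> munit d}.
Hypothesis mu_gen : forall a, mu (x a) = mgen a.
Hypothesis x_gen : generated (range x) = setT.
Notation gam n := (@lower_central G n).
Notation b := (lyndon_comm x).
Implicit Types (u v w z : seq 'I_d).

Lemma munit_deg_gam n g : 0 < n -> gam n g -> munit_deg n (mu g).
Proof. by case: n => // n _; exact: munit_deg_lcs. Qed.

(** By induction along the standard factorization [w = u ++ v]: in the ring
    commutator of the leading terms, one product starts with [u ++ v], the other
    one with the larger word [v ++ u]. *)
Lemma lyndon_comm_lead w : lyndon w -> mu (b w) w = 1%R /\
  forall z, size z = size w -> lex z w -> mu (b w) z = 0%R.
Proof.
have [n] := ubnP (size w); elim: n w => // n IHn w wn lw.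
have w0 := lyndon_nil lw.
have [w1|w1] := ltnP 1 (size w); last first.
  case: w w0 w1 {wn lw} => [|a [|c w]] // _ _; rewrite lyndon_comm1 mu_gen.
  split=> [|[|c [|c' z]] //= _]; first by rewrite /= /mgen_val eqxx.
  rewrite andbF orbF => ca; rewrite /mgen_val /= eqseq_cons.
  by case: eqVneq ca => // ->; rewrite ltnn.
have [s1 s2 s12] := size_std w1; have := lyndon_std lw w1.
have E := lyndon_commE x w1.
move: (stdP w1) s1 s2 s12 E; case: (std w) => u v /= [wE u0 v0 _] s1 s2 s12 E [lu lv uv].
have [|uu u_lt] := IHn u _ lu; first by lia.
have [|vv v_lt] := IHn v _ lv; first by lia.
have gamL t : lyndon t -> munit_deg (size t) (mu (b t)).
  move=> lt; apply: munit_deg_gam; first by rewrite lt0n size_eq0 lyndon_nil.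
  by apply: lyndon_comm_gam; exact: lyndon_nil.
have muE z : size z = size w -> mu (b w) z =
    (mu (b u) (take (size u) z) * mu (b v) (drop (size u) z)
     - mu (b v) (take (size v) z) * mu (b u) (drop (size v) z))%R.
  move=> zw; rewrite E.
  have -> : mu [~ b u, b v] = [~ mu (b u), mu (b v)].
    by rewrite (@mult_onR _ _ setT) //; exact: mult_onW.
  rewrite (munit_deg_comm s1 s2) ?zw ?s12 ?eqxx //; [exact: gamL..|lia].
have second z : size z = size w -> lexle z w ->
    (mu (b v) (take (size v) z) * mu (b u) (drop (size v) z) = 0)%R.
  move=> zw le; have szv : size (take (size v) z) = size v.
    by rewrite size_takel // zw -s12 leq_addl.
  have szu : size (drop (size v) z) = size u by rewrite size_drop zw -s12 addnK.
  have : lex z (v ++ u).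
    apply: (lexle_lt_trans le); apply: lex_trans (lex_cat v u0).
    by rewrite wE; exact: lyndon_cat_lt.
  move=> lt; have := lt; rewrite -[X in lex X _](cat_take_drop (size v) z).
  have [lt1|ge1] := boolP (lex (take (size v) z) v); first by rewrite v_lt ?mul0r.
  move=> lt'; have := lexle_cat2 (drop (size v) z) u szv.
  rewrite /lexle lt' orbT (negPf ge1) /= => /esym/andP[/eqP zv _].
  by move: lt'; rewrite {1}zv lex_cat2l => /u_lt ->; rewrite ?mulr0.
split.
  rewrite muE // second ?lexle_refl // wE take_size_cat // drop_size_cat //.
  by rewrite uu vv mulr1 subr0.
move=> z zw lt; rewrite muE // second ?subr0 //; last by rewrite /lexle lt orbT.
have szu : size (take (size u) z) = size u.
  by rewrite size_takel // zw -s12 leq_addr.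
have [lt1|ge1] := boolP (lex (take (size u) z) u); first by rewrite u_lt ?mul0r.
have lt' : lex (take (size u) z ++ drop (size u) z) (u ++ v).
  by rewrite cat_take_drop -wE.
have := lexle_cat2 (drop (size u) z) v szu.
rewrite /lexle lt' orbT (negPf ge1) /= => /esym/andP[/eqP zu _].
have szv : size (drop (size u) z) = size v by rewrite size_drop zw -s12 addKn.
by move: lt'; rewrite {1}zu lex_cat2l => /v_lt ->; rewrite ?mulr0.
Qed.

Lemma fa_section_gam n : 0 < n ->
  fa_section (gam n) (gam n.+1) (size (lyndon_words d n)).
Proof.
move=> n0; set r := size _; pose w_ (i : 'I_r) := nth [::] (lyndon_words d n) i.
have w_P i : lyndon (w_ i) /\ size (w_ i) = n.
  have := mem_nth [::] (ltn_ord i); rewrite -/(w_ i) mem_lyndon_words.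
  by move=> /andP[? /eqP].
have w_inj : injective w_.
  move=> i j /eqP; rewrite nth_uniq ?lyndon_words_uniq // => /eqP; exact: val_inj.
have nA := lower_central_normal G n; have nB := lower_central_normal G n.+1.
have bA i : gam n (b (w_ i)).
  have [lw wn] := w_P i; rewrite -[in gam n]wn; apply: lyndon_comm_gam.
  exact: lyndon_nil.
apply: (@fa_section_of_basis _ _ _ _ (fun i => b (w_ i))) => //.
- exact: nA.1.
- exact: gam_le.
- by apply: (subset_trans (gam_comm n0 n0)); apply: gam_le; lia.
- apply: (subset_trans (gam_sub_lyndon_span x_gen n0)).
  apply: generated_sub (generated_subgroup _) _ => g [[w [lw wn _ ->]]|gn].
    apply: sub_generated; left.
    have wL : w \in lyndon_words d n by rewrite mem_lyndon_words lw wn eqxx.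
    have iL : index w (lyndon_words d n) < r by rewrite index_mem.
    by exists (Ordinal iL) => //=; rewrite /w_ /= nth_index.
  by apply: sub_generated; right.
move=> v vB; apply/rowP => i0; rewrite mxE; apply/eqP/negPn/negP => vi0.
(* only one summand contributes to the coefficient of the smallest word that *)
(* occurs in the combination                                                 *)
pose s := [seq w_ i | i <- enum 'I_r & v ord0 i != 0%R].
have [] := @exists_min _ s.
  apply/eqP => s0; suff : w_ i0 \in s by rewrite s0.
  by apply/mapP; exists i0; rewrite // mem_filter mem_enum vi0.
move=> _ /mapP[i + ->]; rewrite mem_filter => /andP[vi _] min_i.
have [lwi wi] := w_P i.
pose f g : mulZ := mu g (w_ i).
have fM : mult_on (gam n) f.
  move=> g h gn hn; rewrite /f gmulfM [LHS](@munit_degM _ n) //.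
  - exact: munit_deg_gam.
  - exact: munit_deg_gam.
  - by rewrite wi n0 leqnn.
have zE (y z : int) : zpow (y : mulZ) z = (y * z)%R.
  have XE m : (y : mulZ) ^+ m = (y *+ m)%R.
    by elim: m => // m IHm; rewrite expgS IHm mulrS.
  by rewrite -mulrzz; case: z => m; rewrite /zpow XE.
have f0 : f (zcomb (fun i => b (w_ i)) v) = 0%R.
  by apply: (munit_deg_gam _ vB) => //; rewrite wi n0 leqnn.
have fE : f (zcomb (fun i => b (w_ i)) v) =
    (\sum_(j < r) f (b (w_ j)) * v ord0 j)%R.
  rewrite (mult_on_prod nA.1 fM _).2; last by move=> j; exact: subgroup_zpow nA.1 _.
  have sE (F : 'I_r -> int) : \prod_(j < r) (F j : mulZ) = (\sum_(j < r) F j)%R by [].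
  rewrite -sE; apply: eq_bigr => j _.
  by rewrite (mult_on_zpow _ nA.1 fM (bA j)).2 zE.
move: f0; rewrite fE (bigD1 i) //= big1 ?addr0 => [|j ji].
  by rewrite /f (lyndon_comm_lead lwi).1 mul1r => /eqP; rewrite (negPf vi).
have [->|vj] := eqVneq (v ord0 j) 0%R; first by rewrite mulr0.
have [lwj wj] := w_P j.
have /min_i : w_ j \in s by apply/mapP; exists j; rewrite // mem_filter mem_enum vj.
rewrite /lexle => /orP[/eqP/w_inj ij|lt]; first by rewrite ij eqxx in ji.
by rewrite /f (lyndon_comm_lead lwj).2 ?mul0r // wi wj.
Qed.

End Independence.

(** * Lower central sections of free groups *)

Section FreeGroup.
Local Open Scope classical_set_scope.
Local Open Scope group_scope.
Variable d : nat.
Notation E := (free_group 'I_d).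

Lemma free_gen_generated : generated (range (@free_gen 'I_d)) = [set: E].
Proof.
apply/seteqP; split=> // a _; rewrite -[a]free_product_reprK.
have sg := generated_subgroup (range (@free_gen 'I_d)).
elim: (free_product_repr a) => [|[i z] s IHs]; first exact: sg.1.
have -> : free_product_pi (existT _ i z :: s) =
    @free_product_in _ (fun=> mulZ) i z * free_product_pi s :> E.
  exact/esym/(@free_product_mulE _ _ [:: existT _ i z]).
apply: (subgroupM sg) IHs.
pose one : mulZ := (1%R : int).
have -> : z = zpow one z.
  have XE m : one ^+ m = (m%:Z)%R.
    by elim: m => // m IHm; rewrite expgS IHm; exact: intS.
  by case: z => m; rewrite /zpow XE.
have -> : @free_product_in _ (fun=> mulZ) i (zpow one z) = zpow (free_gen i) z.
  have fM : mult_on [set: mulZ] (@free_product_in _ (fun _ : 'I_d => mulZ) i).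
    exact: mult_onW.
  by rewrite (mult_on_zpow z (subgroup_setT _) fM I).2.
by apply: subgroup_zpow sg _; apply: sub_generated; exists i.
Qed.

Lemma fa_section_free_group n : 0 < n ->
  fa_section (@lower_central E n) (@lower_central E n.+1)
    (size (lyndon_words d n)).
Proof.
have [mu [muE _]] := free_group_basis (@mgen d).
exact: (@fa_section_gam d E (@free_gen 'I_d) mu muE free_gen_generated).
Qed.

End FreeGroup.

(** * The Baer invariant *)

Section Assembly.
Local Open Scope classical_set_scope.
Local Open Scope group_scope.

Lemma section_group_free_abelian (G : groupType) (A : subgroup G)
    (B : normal_subgroup G) r :
  fa_section (subgroup_set A) (normal_set B) r ->
  isomorphic (section_group A B) (free_abelian r).
Proof.
move=> [phi [phiM phi_onto phiK]]; have sA := subgroup_setP A.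
pose S := subgroup_type A; pose N := NormalSubgroup (sub_in_normal A B).
have AS (x : S) : subgroup_set A (val x) by apply: set_mem; exact: (valP x).
have phiE (x y : S) : phi (val x) = phi (val y) <-> coset_of N x = coset_of N y.
  have AV := subgroupV sA (AS x).
  apply: iff_trans (iff_sym (coset_ofP N x y)).
  change (phi (val x) = phi (val y) <-> normal_set B ((val x)^-1 * val y)).
  rewrite -phiK; last exact: subgroupM sA AV (AS y).
  rewrite phiM // (mult_onV sA phiM (AS x)); split=> [->|xy]; first by rewrite mulVg.
  by apply: (mulgI (phi (val x))^-1); rewrite xy mulVg.
pose f (a : quotient_group N) := phi (val (quotient_repr a)).
have fE x : f (coset_of N x) = phi (val x).
  by apply/phiE; exact: quotient_reprK.
have fM : {morph f : a b / a * b}.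
  move=> a b; rewrite -(quotient_reprK a) -(quotient_reprK b) -gmulfM !fE.
  by rewrite -phiM //; exact: AS.
have ex v : exists a, f a = v.
  have [x Ax <-] := phi_onto v; have xA : x \in subgroup_set A by exact: mem_set.
  by exists (coset_of N (Sub x xA : S)); rewrite fE SubK.
have [g gK] := choice ex.
exists (hom_of fM), g => // a /=; rewrite -[RHS]quotient_reprK -[LHS]quotient_reprK.
by apply/phiE; exact: gK.
Qed.

(** As the factors are cyclic, generators of the free product commute modulo the
    cartesian subgroup, which therefore contains [gamma_2]. *)
Lemma free_nilpotent_relations m n : 0 < n ->
  normal_set (nilpotent_relations (fun _ : 'I_m => mulZ) n) =
  @lower_central (free_group 'I_m) n.+1.
Proof.
move=> n0; apply/seteqP; split=> [z [] //|z zn]; split=> //.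
move: z zn; apply: (subset_trans (gam_le (_ : 2 <= n.+1))) => //.
have nC := normal_closure_normal [set z | exists i j, i != j /\
    comm_subgroup (range (@free_product_in 'I_m (fun=> mulZ) i))
                  (range (@free_product_in 'I_m (fun=> mulZ) j)) z].
have -> : @lower_central (free_group 'I_m) 2 =
    comm_subgroup (generated (range (@free_gen 'I_m)))
                  (generated (range (@free_gen 'I_m))).
  by rewrite free_gen_generated.
apply: (comm_generated_sub nC) => _ _ [i _ <-] [j _ <-].
have [->|ij] := eqVneq i j; first by rewrite commgg; exact: nC.1.1.
move=> C [_ sC]; apply: sC; exists i, j; split=> //.
by apply: mem_comm_subgroup; eexists.
Qed.

(** An isomorphism between quotients of projective groups lifts in both
    directions. *)
Lemma lift_isomorphism (E F : groupType) (S : normal_subgroup E)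
    (R : normal_subgroup F) :
  projective_on [set: E] -> projective_on [set: F] ->
  isomorphic (quotient_group S) (quotient_group R) ->
  exists (alpha : F -> E) (beta : E -> F),
  [/\ mult_on setT alpha, mult_on setT beta,
      forall x, normal_set R x <-> normal_set S (alpha x),
      forall y, normal_set S y -> normal_set R (beta y)
    & (forall x, normal_set R (x^-1 * beta (alpha x))) /\
      (forall y, normal_set S (y^-1 * alpha (beta y)))].
Proof.
move=> projE projF [th [th' thK th'K]].
have onto G (N : normal_subgroup G) (c : quotient_group N) : exists b, coset_of N b = c.
  by exists (quotient_repr c); exact: quotient_reprK.
have th'M : {morph th' : x y / x * y} by apply: (can2_gmulfM thK th'K).
have bM' : mult_on setT (th \o coset_of S) by move=> x y _ _; rewrite /= !gmulfM.
have [beta [bM bE]] := projE _ _ (coset_of R) (th \o coset_of S) (@onto _ R) bM'.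
have aM' : mult_on setT (th' \o coset_of R).
  by move=> x y _ _; rewrite /= gmulfM th'M.
have [alpha [aM aE]] := projF _ _ (coset_of S) (th' \o coset_of R) (@onto _ S) aM'.
have c1P G (N : normal_subgroup G) x : normal_set N x <-> coset_of N x = 1.
  by case: N x => N nN x; rewrite coset_eq1P.
have th1 : th 1 = 1 by exact: gmorph1.
have th'1 : th' 1 = 1 by rewrite -th1 thK.
exists alpha, beta; split=> //.
- move=> x; rewrite !c1P (aE x I) /=; split=> [-> //|].
  by move=> /(congr1 th); rewrite th'K th1.
- by move=> y; rewrite !c1P (bE y I) /= => ->.
- split=> [x|y]; apply/coset_ofP; first by rewrite (bE _ I) /= (aE x I) /= th'K.
  by rewrite (aE _ I) /= (bE y I) /= thK.
Qed.

(** The section is abelian because [[gamma_a, gamma_a]] is contained in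
    [gamma_(2a)]; so its lower central factors can be glued. *)
Lemma fa_section_free_nilpotent d a b : 0 < a -> b <= a ->
  fa_section (@lower_central (free_group 'I_d) a)
             (@lower_central (free_group 'I_d) (a + b))
    (\sum_(a <= i < a + b) size (lyndon_words d i)).
Proof.
move=> a0; elim: b => [|b IHb] ba.
  rewrite addn0 big_geq //; exists (fun=> 1); split=> // [x y _ _|v].
    by rewrite mulg1.
  exists (1 : free_group 'I_d); first exact: (lower_central_normal _ a).1.1.
  by apply/rowP => -[].
have nG k := lower_central_normal (free_group 'I_d) k.
rewrite addnS big_nat_recr ?leq_addr //=.
apply: (@fa_section_glue _ _ (@lower_central (free_group 'I_d) (a + b))).
- exact: (nG _).1.
- exact: (nG _).1.
- exact: nG.
- exact: gam_le.
- by apply: gam_le; rewrite leq_addr.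
- by apply: (subset_trans (gam_comm a0 a0)); apply: gam_le; lia.
- by apply: IHb; exact: ltnW.
- by apply: fa_section_free_group; lia.
Qed.

Lemma size_lyndon_words1 d : size (lyndon_words d 1) = d.
Proof.
by have := sum_lyndon_words d (ltn0Sn 0); rewrite big_seq1 mul1n expn1.
Qed.

(** The section [H / K] is also the abelianization of a free group [E] of rank
    [N]. As [H] and [E] are projective, there are homomorphisms between them over
    this abelian group, and by [fa_section_lcs] the next section of [(K, H)] is
    the factor of weight [c.+1] of [E]. *)
Lemma fa_section_step (F : groupType) (H K : set F) N c :
  projective_on [set: F] -> is_normal H -> is_normal K -> K `<=` H ->
  fa_section H K N ->
  fa_section (lcs H H c) (lcs K H c) (size (lyndon_words N c.+1)).
Proof.
move=> projF nH nK sKH [phi [phiM phi_onto phiK]].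
pose E := free_group 'I_N; have nT := normal_setT E.
have projE : projective_on [set: E] by exact/free_projective/free_group_is_free.
have [] := @fa_section_free_group N 1 isT; rewrite size_lyndon_words1.
move=> pi [piM pi_onto piK].
pose pi' : {multiplicative E -> free_abelian N} := hom_of (fun x y => piM x y I I).
have pi'_onto v : exists y, pi' y = v by have [y _ <-] := pi_onto v; exists y.
have projH : projective_on H := subgroup_projective projF nH.1.
have [alpha [aM aE]] := projH _ _ pi' phi pi'_onto phiM.
pose A := Subgroup nH.1.
have AH (x : subgroup_type A) : H (val x) by apply: set_mem; exact: (valP x).
have phi'M : {morph (fun x : subgroup_type A => phi (val x)) : x y / x * y}.
  by move=> x y /=; rewrite -phiM //; exact: AH.
have phi'_onto v : exists x, hom_of phi'M x = v.
  have [x Hx <-] := phi_onto v; have xA : x \in subgroup_set A by exact: mem_set.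
  by exists (Sub x xA : subgroup_type A).
have [beta [bM bE]] := projE _ _ (hom_of phi'M) pi phi'_onto piM.
pose K2 := @lower_central E 2.
have phi_ba x : H x -> phi (val (beta (alpha x))) = phi x.
  by move=> Hx; rewrite -(aE x Hx); exact: bE.
have phiF x y : H x -> H y -> phi y = phi x -> K (x^-1 * y).
  move=> Hx Hy xy; have HV := subgroupV nH.1 Hx; apply/phiK.
    exact: subgroupM nH.1 HV Hy.
  by rewrite phiM // (mult_onV nH.1 phiM) // xy mulVg.
have piF x y : pi y = pi x -> K2 (x^-1 * y).
  move=> xy; apply/piK => //.
  by rewrite piM // (mult_onV (subgroup_setT E) piM) // xy mulVg.
have pib y : phi (val (beta y)) = pi y by exact: bE.
apply: (@fa_section_lcs _ _ _ _ setT K2 alpha (fun y => val (beta y))) => //.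
- exact: lower_central_normal.
- by move=> x y _ _; rewrite bM.
- move=> x Kx; apply/piK => //; rewrite [LHS](aE x (sKH _ Kx)).
  by apply/phiK => //; exact: sKH.
- by move=> y K2y; apply/phiK; [exact: AH | rewrite pib; apply/piK].
- by move=> x Hx; apply: phiF; rewrite ?phi_ba.
- by move=> y _; apply: piF; rewrite [LHS](aE _ (AH _)) pib.
- have -> : lcs K2 setT c = @lower_central E c.+2.
    by rewrite (_ : K2 = lcs setT setT 1) // lcsD addn1.
  exact: (@fa_section_free_group N c.+1).
Qed.

Lemma fa_section_series (F : groupType) (KH : set F * set F) N cs :
  projective_on [set: F] -> is_normal KH.2 -> is_normal KH.1 -> KH.1 `<=` KH.2 ->
  fa_section KH.2 KH.1 N ->
  let KH' := foldl (@series_step F) KH cs in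
  fa_section KH'.2 KH'.1 (foldl (fun r c => size (lyndon_words r c.+1)) N cs).
Proof.
move=> projF; elim: cs KH N => [|c cs IHcs] KH N nH nK sKH HKN //.
apply: (IHcs (series_step KH c)) => /=;
  [exact: lcs_normal | exact: lcs_normal | exact: lcs_monol |].
exact: fa_section_step.
Qed.

Lemma series_sub (F : groupType) (KH : set F * set F) cs : is_normal KH.2 ->
  (foldl (@series_step F) KH cs).2 `<=` KH.2.
Proof.
elim: cs KH => [|c cs IHcs] KH nH //=.
apply: subset_trans (lcsW nH nH (leq0n c)).
by apply: (IHcs (series_step KH c)); exact: lcs_normal.
Qed.

End Assembly.

Theorem theorem2p11 (n m c1 : nat) (cs : seq nat)
  (n_gt0 : (0 < n)%N) (m_gt0 : (0 < m)%N)
  (c1_gt0 : (0 < c1)%N) (cs_gt0 : forall c, c \in cs -> (0 < c)%N)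
  (n_le_c1 : (n <= c1)%N)
  (F : groupType) (F_free : is_free F) (R : normal_subgroup F)
  (F_presents_G :
     isomorphic (nilpotent_product (fun _ : 'I_m => mulZ) n)
                (quotient_group R)) :
  exists2 r : nat,
    (r%:R)%R = baer_rank n m c1 cs &
    isomorphic (baer_invariant R (polynilpotent_laws c1 cs)) (free_abelian r).
Proof.
have projF := free_projective F_free.
have projE := free_projective (free_group_is_free 'I_m).
have [alpha [beta [aM bM aR bS [ba ab]]]] := lift_isomorphism projE projF F_presents_G.
have nR := normal_setP R; have nT := normal_setT F.
move: aR bS ab; rewrite (free_nilpotent_relations m n_gt0) => aR bS ab.
pose N := \sum_(c1.+1 <= i < (c1 + n).+1) size (lyndon_words m i).
have base : fa_section (lcs setT setT c1) (lcs (normal_set R) setT c1) N.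
  apply: (@fa_section_lcs _ _ _ _ setT (@lower_central (free_group 'I_m) n.+1)
    alpha beta) => //; first exact: lower_central_normal.
    by move=> x; apply: (aR x).1.
  rewrite -[@lower_central _ n.+1]/(lcs setT setT n) lcsD.
  exact: (@fa_section_free_nilpotent m c1.+1 n isT (leqW n_le_c1)).
exists (foldl (fun r c => size (lyndon_words r c.+1)) N cs).
  rewrite /baer_rank.
  have -> : (\sum_(c1.+1 <= i < (c1 + n).+1) chi i m%:R = N%:R)%R.
    rewrite GRing.natr_sum; apply: eq_big_nat => i /andP[ci _]; apply: chi_lyndon.
    exact: leq_ltn_trans ci.
  elim: cs N {cs_gt0 base} => //= c cs IHcs N.
  by rewrite IHcs chi_lyndon.
apply: section_group_free_abelian; rewrite /= marginal_polynilpotent.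
rewrite (verbal_polynilpotent R).
have -> : (normal_set R `&` (polynilpotent_series (normal_set R) (c1 :: cs)).2)%classic
    = (polynilpotent_series (normal_set R) (c1 :: cs)).2.
  have sub := @series_sub F (series_step (normal_set R, setT) c1) cs
    (lcs_normal c1 nT nT).
  apply: setIidr; apply: (subset_trans sub) => x xc; apply/aR.
  apply: (@gam_le _ n.+1 c1.+1 n_le_c1).
  by apply: (lcs_image (H := setT) (K := setT)) xc.
apply: fa_section_series => //=; [exact: lcs_normal|exact: lcs_normal|exact: lcs_monol].
Qed.
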